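(* Let $M=H=(H^{2m};J,G)\in\mathcal C_2$ (i.e. $H$ is a semi-Kähler manifold) and let $f:H\to N$ be a $(\pm)$-holomorphic map. (i) If $N\in\mathcal A_1\cup\mathcal A_4^a\cup\mathcal B_1\cup\mathcal C_1$, then $f$ is harmonic. In particular, if $H\in\mathcal C_1$ and $N\in\mathcal A_1\cup\mathcal A_4^a\cup\mathcal B_1\cup\mathcal C_1$, then $f$ is pluriharmonic (and therefore harmonic). (ii) If $N\in\mathcal A_3\cup\mathcal B_3$, then $f$ is harmonic if and only if it is constant. (iii) If $N\in\mathcal B_2$ (i.e. $N$ is semi-cosymplectic) with $\dim N=1+\dim H$ and $f$ is weakly conformal, then $f$ is harmonic.
   Context: Manifolds and maps are smooth; $\nabla$ denotes Levi-Civita connections. An almost Hermitian manifold $H=(H^{2m};J,G)$ has $S^H(X,Y)=(\nabla_XJ)Y-(\nabla_YJ)X$ and $\Phi(X,Y)=G(X,JY)$. $\mathcal C_1$: Kähler ($\nabla J=0$), nearly Kähler ($(\nabla_XJ)X=0$), almost Kähler ($d\Phi=0$) or quasi-Kähler ($S^H(JX,X)=0$) manifolds. $\mathcal C_2$: semi-Kähler manifolds: $\sum_{i=1}^mS^H(Je_i,e_i)=0$ for local orthonormal frames $\{e_i;Je_i\}$. An almost contact metric manifold $N=(N^{2n+1};\phi,\gamma,\sigma,h)$ is a $(2n+1)$-dimensional Riemannian manifold with a $(1,1)$-tensor $\phi$, a vector field $\gamma$ and a 1-form $\sigma$ such that $\phi^2X=-X+\sigma(X)\gamma$, $\sigma(\gamma)=1$,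 $h(\phi X,\phi Y)=h(X,Y)-\sigma(X)\sigma(Y)$. Put $\Omega(X,Y)=h(X,\phi Y)$, $P(X,Y)=(\nabla_X\phi)Y+(\nabla_{\phi X}\phi)\phi Y$, $W_X=\nabla_XX+\nabla_{\phi X}(\phi X)$, $2\mathfrak h=\mathcal L_\gamma\phi$. Conventions: $2d\sigma(X,Y)=X\sigma(Y)-Y\sigma(X)-\sigma([X,Y])$; $d\Omega(X,Y,Z)$ is the cyclic sum of $(\nabla_X\Omega)(Y,Z)$ and $(\sigma\wedge\Omega)(X,Y,Z)$ the cyclic sum of $\sigma(X)\Omega(Y,Z)$; for any local orthonormal frame $\{v_i;\phi v_i;\gamma\}_{1\le i\le n}$, $\delta\sigma=\sigma(\sum_iW_{v_i})=-\operatorname{div}\gamma$ and $\delta\Omega(X)=h(-\phi(\nabla_\gamma\gamma)+\sum_iP(v_i,v_i),X)$. $N$ is normal if $[\phi,\phi]+2d\sigma\otimes\gamma=0$, where $[\phi,\phi](X,Y)=\phi^2[X,Y]+[\phi X,\phi Y]-\phi[\phi X,Y]-\phi[X,\phi Y]$. Classes. $\mathcal A_1$: $\alpha$-contact metric manifolds ($d\sigma=\alpha\Omega$, $\alpha\neq0$ a real constant); quasi-contact metric manifolds ($P(X,Y)=2h(X,Y)\gamma-\sigma(Y)\{X+\sigma(X)\gamma+\mathfrak hX\}$); quasi-$\mathcal K$-Sasakian manifolds ($P(X,Y)=2h(X,Y)\gamma-2\sigma(Y)X+\sigma(Y)\nabla_{\phi X}\gamma$); strongly pseudoconvex CR-manifolds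 ($d\sigma=\Omega$ and $(\nabla_X\phi)Y=h(X+\mathfrak hX,Y)\gamma-\sigma(Y)(X+\mathfrak hX)$); $\alpha$-Sasakian manifolds ($d\sigma=\alpha\Omega$, $\alpha\ne0$ constant, and normal). $\mathcal A_3$: trans-Sasakian manifolds of type $(\wp,\theta)$: normal with $(\nabla_X\phi)Y=\wp\{h(X,Y)\gamma-\sigma(Y)X\}+\theta\{h(\phi X,Y)\gamma-\sigma(Y)\phi X\}$, where $2n\wp=\delta\Omega(\gamma)$, $2n\theta=-\delta\sigma$ and $\wp,\theta$ vanish nowhere. $\mathcal A_4^a$: almost quasi-Sasakian manifolds ($d\Omega=0$, and $\sigma\wedge(d\sigma)^r\neq0$, $(d\sigma)^{r+1}=0$ for some $1\le r\le n-1$). $\mathcal B_1$: cosymplectic ($d\sigma=0$, $d\Omega=0$, normal), almost cosymplectic ($d\sigma=0$, $d\Omega=0$), nearly cosymplectic ($(\nabla_X\phi)X=0$), nearly-$\mathcal K$-cosymplectic ($(\nabla_X\phi)X=0$ and $(\nabla_X\phi)\gamma=0$), quasi-$\mathcal K$-cosymplectic ($P(X,Y)=\sigma(Y)\nabla_{\phi X}\gamma$) manifolds. $\mathcal B_2$: semi-cosymplectic manifolds ($\delta\sigma=0$, $\delta\Omega=0$, normal). $\mathcal B_3$: almost $\beta$-Kenmotsu manifolds ($d\Omega=2\beta\,\sigma\wedge\Omega$, $d\sigma=0$, $d\beta\wedge\sigma=0$ for a nowhere vanishing smooth function $\beta$), including the $\beta$-Kenmotsu (normal) and the CR-integrable ($(\nabla_X\phi)Y=h(\mathfrak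 hX,Y)\gamma-\sigma(Y)\mathfrak hX+\beta\{h(\phi X,Y)\gamma-\sigma(Y)\phi X\}$) ones. $f$ is $(\pm)$-holomorphic if $f_*J=\pm\psi f_*$ (one fixed sign), where $\psi=\phi$ for an almost contact metric target and $\psi=J_1$ for an almost Hermitian target $(H_1;J_1,G_1)$. $f$ is harmonic if its tension field vanishes; pluriharmonic if $(\nabla f_* )(X,X)+(\nabla f_* )(JX,JX)=0$ for all $X\in\Gamma(TH)$, $\nabla f_*$ the second fundamental form. $f$ is weakly conformal if $h(f_*X,f_*Y)=\mu^2G(X,Y)$ for all $X,Y$ and some function $\mu\ge0$.
   Formalization: In (ii), H is additionally assumed connected; on a disconnected H a map constant on each component with different values is (±)-holomorphic and harmonic but not constant, so the claim fails there. *)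

(* Defs.v *)
(* Differential geometry on top of MathComp-Analysis.  A tensor field is given
   by its components in every chart of the atlas, subject to the usual
   transformation law on overlaps.  Tangent vectors are row vectors, so an
   endomorphism A maps v to v *m A. *)
From HB Require Import structures.
From mathcomp Require Import all_boot all_order all_algebra all_fingroup.
From mathcomp Require Import all_classical all_reals all_analysis ring.

Set Implicit Arguments.
Unset Strict Implicit.
Unset Printing Implicit Defensive.

Import Order.TTheory GRing.Theory Num.Theory.
Import numFieldNormedType.Exports.

Local Open Scope classical_set_scope.
Local Open Scope ring_scope.

Section Smoothness.
Variables (R : realType) (V W : normedModType R).

(* For finite-dimensional V and open U: f is of class C^k on U. *)
Fixpoint Ck_on (k : nat) (U : set V) (f : V -> W) : Prop :=
  match k with
  | 0%N => forall x, U x -> {for x, continuous f}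
  | k'.+1 => (forall x, U x -> differentiable f x) /\
             (forall v : V, Ck_on k' U (fun x => 'D_v f x))
  end.

Definition smooth_on (U : set V) (f : V -> W) : Prop :=
  forall k, Ck_on k U f.

End Smoothness.

(* Smooth manifolds without boundary; connectedness is not built in. *)
Record manifold (R : realType) (n : nat) := Manifold {
  mcarrier :> topologicalType;
  mhausdorff : hausdorff_space mcarrier;
  msecond_countable : @second_countable mcarrier;
  atlas : Type;
  cdom : atlas -> set mcarrier;
  chart : atlas -> mcarrier -> 'rV[R]_n;
  chart_inv : atlas -> 'rV[R]_n -> mcarrier;
  cdom_open : forall a, open (cdom a);
  cdom_cover : forall p, exists a, cdom a p;
  cimg_open : forall a, open (chart a @` cdom a);
  chartK : forall a p, cdom a p -> chart_inv a (chart a p) = p;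
  chart_continuous : forall a p, cdom a p -> {for p, continuous (chart a)};
  chart_inv_continuous : forall a x, (chart a @` cdom a) x ->
    {for x, continuous (chart_inv a)};
  transition_smooth : forall a b,
    smooth_on (chart a @` cdom a `&` chart_inv a @^-1` cdom b)
              (chart b \o chart_inv a)
}.

Definition cimg (R : realType) (n : nat) (M : manifold R n) (a : atlas M) :
  set 'rV[R]_n := chart a @` cdom a.

Section Maps.
Variables (R : realType) (n k : nat) (M : manifold R n) (N : manifold R k).

Definition local_rep (f : M -> N) (a : atlas M) (b : atlas N) :
  'rV[R]_n -> 'rV[R]_k := chart b \o f \o chart_inv a.

Definition local_dom (f : M -> N) (a : atlas M) (b : atlas N) :
  set 'rV[R]_n := cimg a `&` (f \o chart_inv a) @^-1` cdom b.

Definition smooth_map (f : M -> N) : Prop :=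
  continuous f /\
  forall a b, smooth_on (local_dom f a b) (local_rep f a b).

End Maps.

Definition smooth_fun (R : realType) (n : nat) (M : manifold R n) (u : M -> R) :
  Prop := forall a : atlas M, smooth_on (cimg a) (u \o chart_inv a).

Definition ip (R : realType) (n : nat) (B : 'M[R]_n) (v w : 'rV[R]_n) : R :=
  (v *m B *m w^T) 0 0.

Definition ev (R : realType) (n : nat) (s : 'cV[R]_n) (v : 'rV[R]_n) : R :=
  (v *m s) 0 0.

Section TensorFields.
Variables (R : realType) (n : nat) (M : manifold R n).

Let transition (a b : atlas M) : 'rV[R]_n -> 'rV[R]_n :=
  chart b \o chart_inv a.
Let overlap (a b : atlas M) : set 'rV[R]_n :=
  cimg a `&` chart_inv a @^-1` cdom b.

Definition is_vector_field (X : atlas M -> 'rV[R]_n -> 'rV[R]_n) : Prop :=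
  (forall a, smooth_on (cimg a) (X a)) /\
  (forall a b x, overlap a b x ->
     'D_(X a x) (transition a b) x = X b (transition a b x)).

Definition is_oneform (s : atlas M -> 'rV[R]_n -> 'cV[R]_n) : Prop :=
  (forall a, smooth_on (cimg a) (s a)) /\
  (forall a b x, overlap a b x -> forall v,
     ev (s b (transition a b x)) ('D_v (transition a b) x) = ev (s a x) v).

Definition is_endo_field (A : atlas M -> 'rV[R]_n -> 'M[R]_n) : Prop :=
  (forall a, smooth_on (cimg a) (A a)) /\
  (forall a b x, overlap a b x -> forall v,
     'D_(v *m A a x) (transition a b) x =
     'D_v (transition a b) x *m A b (transition a b x)).

Definition is_metric (g : atlas M -> 'rV[R]_n -> 'M[R]_n) : Prop :=
  [/\ forall a, smooth_on (cimg a) (g a),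
      forall a b x, overlap a b x -> forall v w,
        ip (g b (transition a b x)) ('D_v (transition a b) x)
                                    ('D_w (transition a b) x)
        = ip (g a x) v w,
      forall a x, cimg a x -> (g a x)^T = g a x &
      forall a x, cimg a x -> forall v, v != 0 -> 0 < ip (g a x) v v].

End TensorFields.

Record riemannian (R : realType) (n : nat) := Riemannian {
  rmanifold :> manifold R n;
  metric : atlas rmanifold -> 'rV[R]_n -> 'M[R]_n;
  metricP : is_metric metric
}.

Section LocalCalculus.
Variables (R : realType) (n : nat).
Local Notation V := 'rV[R]_n.
Implicit Types (g A : V -> 'M[R]_n) (X Y : V -> V) (s : V -> 'cV[R]_n).

Definition basis_vec (i : 'I_n) : V := delta_mx 0 i.

(* Koszul formula for constant-coefficient fields: the l-th entry is
   g(nabla_v w, e_l). *)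
Definition christoffel1 g (x v w : V) : V :=
  \row_l (2^-1 * ('D_v (fun y => ip (g y) w (basis_vec l)) x
                  + 'D_w (fun y => ip (g y) v (basis_vec l)) x
                  - 'D_(basis_vec l) (fun y => ip (g y) v w) x)).

Definition christoffel g (x v w : V) : V := christoffel1 g x v w *m invmx (g x).

(* Levi-Civita connection of g: (nabla_X Y)(x). *)
Definition nabla g X Y (x : V) : V :=
  'D_(X x) Y x + christoffel g x (X x) (Y x).

(* Below, expressions that are tensorial in vector fields are evaluated at
   tangent vectors by extending these with constant coefficients in the chart
   (cst v, cst w). *)

(* (nabla_v A) w = nabla_v (A w) - A (nabla_v w) *)
Definition nabla_endo g A (x v w : V) : V :=
  nabla g (cst v) (fun y => w *m A y) x - nabla g (cst v) (cst w) x *m A x.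

Definition nabla_form2 g (b : V -> V -> V -> R) (x u v w : V) : R :=
  'D_u (fun y => b y v w) x
  - b x (nabla g (cst u) (cst v) x) w - b x v (nabla g (cst u) (cst w) x).

(* Exterior derivative of a 2-form, with the cyclic-sum convention. *)
Definition d_form2 g (b : V -> V -> V -> R) (x u v w : V) : R :=
  nabla_form2 g b x u v w + nabla_form2 g b x v w u + nabla_form2 g b x w u v.

Definition lie X Y (x : V) : V := 'D_(X x) Y x - 'D_(Y x) X x.

(* Exterior derivative of a 1-form, with the convention
   2 ds(X,Y) = X s(Y) - Y s(X) - s([X,Y]). *)
Definition d_form1_vf s X Y (x : V) : R :=
  2^-1 * ('D_(X x) (fun y => ev (s y) (Y y)) x
          - 'D_(Y x) (fun y => ev (s y) (X y)) x - ev (s x) (lie X Y x)).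

Definition d_form1 s (x v w : V) : R := d_form1_vf s (cst v) (cst w) x.

Definition nijenhuis_vf A X Y (x : V) : V :=
  lie X Y x *m A x *m A x
  + lie (fun y => X y *m A y) (fun y => Y y *m A y) x
  - lie (fun y => X y *m A y) Y x *m A x
  - lie X (fun y => Y y *m A y) x *m A x.

Definition nijenhuis A (x v w : V) : V := nijenhuis_vf A (cst v) (cst w) x.

(* (L_X A) v = [X, A v] - A [X, v] *)
Definition lie_endo X A (x v : V) : V :=
  lie X (fun y => v *m A y) x - lie X (cst v) x *m A x.

Definition divergence g X (x : V) : R :=
  \sum_(i < n) (nabla g (cst (basis_vec i)) X x) 0 i.

Definition orthonormal (T : finType) (B : 'M[R]_n) (e : T -> V) : Prop :=
  forall i j, ip B (e i) (e j) = (i == j)%:R.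

Lemma deriveL (m p : nat) (W : normedModType R) (L : {linear 'M[R]_(m, p) -> W})
    (f : V -> 'M[R]_(m, p)) (x u : V) :
  differentiable f x ->
  differentiable (L \o f) x /\ 'D_u (L \o f) x = L ('D_u f x).
Proof.
move=> df.
have LE : (L : _ -> _) =
    \sum_(i < m) \sum_(j < p) (fun B : 'M[R]_(m, p) => B i j *: L (delta_mx i j)).
  apply/funext => B; rewrite {1}[B]matrix_sum_delta linear_sum fct_sumE.
  by apply: eq_bigr => i _; rewrite linear_sum fct_sumE; apply: eq_bigr => j _;
    rewrite linearZ.
have Ldiff B : differentiable L B.
  rewrite LE; apply: differentiable_sum => i; apply: differentiable_sum => j.
  exact/differentiableZl/differentiable_coord.
have Lcont : continuous L by move=> B; exact: differentiable_continuous.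
have dLf : differentiable (L \o f) x by exact: differentiable_comp.
split=> //; rewrite !deriveE// diff_comp//=.
by rewrite (diff_lin _ Lcont).
Qed.

Lemma derive_ip g (x u v w : V) : differentiable g x ->
  differentiable (fun y => ip (g y) v w) x /\
  'D_u (fun y => ip (g y) v w) x = ip ('D_u g x) v w.
Proof.
move=> dg.
have lin : linear (fun B : 'M[R]_n => ip B v w : R).
  move=> k B C; rewrite /ip mulmxDr mulmxDl -scalemxAr.
  by rewrite -!scalemxAl !mxE.
pose L : {linear 'M[R]_n -> R} :=
  HB.pack (fun B : 'M[R]_n => ip B v w : R)
    (GRing.isLinear.Build _ _ _ _ (fun B : 'M[R]_n => ip B v w : R) lin).
exact: (@deriveL n n R L g x u dg).
Qed.

Lemma christoffel_ip g (x v w z : V) : g x \in unitmx -> differentiable g x ->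
  ip (g x) (christoffel g x v w) z =
  2^-1 * (ip ('D_v g x) w z + ip ('D_w g x) v z - ip ('D_z g x) v w).
Proof.
move=> ug dg.
have C1 l : christoffel1 g x v w 0 l =
    2^-1 * (ip ('D_v g x) w (basis_vec l) + ip ('D_w g x) v (basis_vec l)
            - ip ('D_(basis_vec l) g x) v w).
  by rewrite mxE !(derive_ip _ _ _ dg).2.
have E (B : 'M[R]_n) (t : V) : ip B t z = \sum_l z 0 l * ip B t (basis_vec l).
  rewrite {1}/ip mxE; apply: eq_bigr => l _.
  by rewrite /ip /basis_vec trmx_delta -colE !mxE mulrC.
have D : ip ('D_z g x) v w = \sum_l z 0 l * ip ('D_(basis_vec l) g x) v w.
  rewrite deriveE// {1}[z]row_sum_delta linear_sum /ip mulmx_sumr mulmx_suml.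
  rewrite summxE; apply: eq_bigr => l _.
  by rewrite linearZ/= -scalemxAr -scalemxAl mxE deriveE.
have -> : ip (g x) (christoffel g x v w) z = \sum_l z 0 l * christoffel1 g x v w 0 l.
  rewrite /ip /christoffel mulmxKV// mxE; apply: eq_bigr => l _.
  by rewrite [X in _ * X]mxE mulrC.
have alg (a b c t : 'I_n -> R) :
    \sum_l t l * (2^-1 * (a l + b l - c l)) =
    2^-1 * (\sum_l t l * a l + \sum_l t l * b l - \sum_l t l * c l).
  rewrite -big_split -sumrB mulr_sumr; apply: eq_bigr => l _ /=.
  by rewrite mulrCA; congr (_ * _); rewrite mulrBr mulrDr.
rewrite D (E ('D_v g x) w) (E ('D_w g x) v) -alg.
by apply: eq_bigr => l _; rewrite C1.
Qed.

Lemma ip_sym (B : 'M[R]_n) (v w : V) : B^T = B -> ip B v w = ip B w v.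
Proof.
move=> BT; rewrite /ip -[v *m B *m w^T]trmxK [LHS]mxE.
by rewrite !trmx_mul trmxK BT mulmxA.
Qed.

(* The two properties characterizing the Levi-Civita connection. *)
Lemma nabla_torsion_free g X Y (x : V) : (\near x, (g x)^T = g x) ->
  nabla g X Y x - nabla g Y X x = lie X Y x.
Proof.
move=> gT; rewrite /nabla /lie.
suff -> : christoffel g x (Y x) (X x) = christoffel g x (X x) (Y x).
  by rewrite opprD addrACA subrr addr0.
rewrite /christoffel; congr (_ *m _); apply/rowP => l; rewrite !mxE.
rewrite [X in _ * (X - _)]addrC; congr (_ * (_ - _)).
by apply: near_eq_derive; apply: filterS gT => y gy; exact: ip_sym.
Qed.

Lemma nabla_metric g (x u v w : V) : g x \in unitmx -> differentiable g x ->
  (\near x, (g x)^T = g x) ->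
  'D_u (fun y => ip (g y) v w) x =
  ip (g x) (nabla g (cst u) (cst v) x) w + ip (g x) v (nabla g (cst u) (cst w) x).
Proof.
move=> ug dg gT; have gxT : (g x)^T = g x by exact: nbhs_singleton gT.
have dsym (t a b : V) : ip ('D_t g x) a b = ip ('D_t g x) b a.
  rewrite -!(derive_ip _ _ _ dg).2; apply: near_eq_derive.
  by apply: filterS gT => y gy; exact: ip_sym.
have nablaE t : nabla g (cst u) (cst t) x = christoffel g x u t.
  by rewrite /nabla derive_cst add0r.
rewrite !nablaE (ip_sym v _ gxT) (christoffel_ip u v w ug dg).
rewrite (christoffel_ip u w v ug dg) (derive_ip u v w dg).2 (dsym u w v).
have alg (a b c : R) : a = 2^-1 * (a + b - c) + 2^-1 * (a + c - b) by field.
exact: alg.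
Qed.

End LocalCalculus.

Section ExteriorAlgebra.
Variables (R : realType) (n : nat).

Definition form (k : nat) : Type := ('I_k -> 'rV[R]_n) -> R.

Definition wedge (p q : nat) (w1 : form p) (w2 : form q) : form (p + q) :=
  fun v => (p`! * q`!)%:R^-1 * \sum_(t : 'S_(p + q)) (-1) ^+ t
    * w1 (fun i => v (t (lshift q i))) * w2 (fun j => v (t (rshift p j))).

Fixpoint wedge_pow (w : form 2) (r : nat) : form (r * 2) :=
  match r with
  | 0%N => fun _ => 1
  | r'.+1 => wedge w (@wedge_pow w r')
  end.

End ExteriorAlgebra.

Arguments wedge_pow {R n} w r.

Record almost_hermitian (R : realType) (m : nat) := AlmostHermitian {
  ah_riem :> riemannian R m.*2;
  J_ : atlas ah_riem -> 'rV[R]_(m.*2) -> 'M[R]_(m.*2);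
  J_field : is_endo_field J_;
  J_sqr : forall a x, cimg a x -> J_ a x *m J_ a x = - 1%:M;
  J_compat : forall a x, cimg a x -> forall v w,
    ip (metric a x) (v *m J_ a x) (w *m J_ a x) = ip (metric a x) v w
}.

Section AlmostHermitian.
Variables (R : realType) (m : nat) (H : almost_hermitian R m).
Local Notation V := 'rV[R]_(m.*2).
Implicit Types (a : atlas H) (x v w : V).

Definition nablaJ a x v w : V := nabla_endo (metric a) (J_ a) x v w.

Definition SH a x v w : V := nablaJ a x v w - nablaJ a x w v.

Definition Phi a x v w : R := ip (metric a x) v (w *m J_ a x).

Definition kahler : Prop :=
  forall a x, cimg a x -> forall v w, nablaJ a x v w = 0.
Definition nearly_kahler : Prop :=
  forall a x, cimg a x -> forall v, nablaJ a x v v = 0.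
Definition almost_kahler : Prop :=
  forall a x, cimg a x -> forall u v w,
    d_form2 (metric a) (Phi a) x u v w = 0.
Definition quasi_kahler : Prop :=
  forall a x, cimg a x -> forall v, SH a x (v *m J_ a x) v = 0.

Definition class_C1 : Prop :=
  kahler \/ nearly_kahler \/ almost_kahler \/ quasi_kahler.

(* {e_i; J e_i} is an orthonormal basis of the tangent space. *)
Definition J_frame a x (e : 'I_m -> V) : Prop :=
  orthonormal (metric a x) (fun i : 'I_m + 'I_m =>
    match i with inl i => e i | inr i => e i *m J_ a x end).

Definition semi_kahler : Prop :=
  forall a x, cimg a x -> forall e, J_frame a x e ->
    \sum_(i < m) SH a x (e i *m J_ a x) (e i) = 0.

End AlmostHermitian.

Record almost_contact (R : realType) (n : nat) := AlmostContact {
  ac_riem :> riemannian R n.*2.+1;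
  phi_ : atlas ac_riem -> 'rV[R]_(n.*2.+1) -> 'M[R]_(n.*2.+1);
  gamma_ : atlas ac_riem -> 'rV[R]_(n.*2.+1) -> 'rV[R]_(n.*2.+1);
  sigma_ : atlas ac_riem -> 'rV[R]_(n.*2.+1) -> 'cV[R]_(n.*2.+1);
  phi_field : is_endo_field phi_;
  gamma_field : is_vector_field gamma_;
  sigma_form : is_oneform sigma_;
  phi_sqr : forall a x, cimg a x -> forall v,
    v *m phi_ a x *m phi_ a x = - v + ev (sigma_ a x) v *: gamma_ a x;
  sigma_gamma : forall a x, cimg a x -> ev (sigma_ a x) (gamma_ a x) = 1;
  phi_compat : forall a x, cimg a x -> forall v w,
    ip (metric a x) (v *m phi_ a x) (w *m phi_ a x) =
    ip (metric a x) v w - ev (sigma_ a x) v * ev (sigma_ a x) w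
}.

Section AlmostContact.
Variables (R : realType) (n : nat) (N : almost_contact R n).
Local Notation V := 'rV[R]_(n.*2.+1).
Implicit Types (a : atlas N) (x u v w : V) (f : N -> R).

Local Notation h := metric.
Local Notation phi := phi_.
Local Notation gamma := gamma_.

Definition sg a x v : R := ev (sigma_ a x) v.

Definition nablaphi a x v w : V := nabla_endo (h a) (phi a) x v w.

Definition nablagamma a x v : V := nabla (h a) (cst v) (gamma a) x.

Definition Omega a x v w : R := ip (h a x) v (w *m phi a x).

Definition PN a x v w : V :=
  nablaphi a x v w + nablaphi a x (v *m phi a x) (w *m phi a x).

Definition hN a x v : V := 2^-1 *: lie_endo (gamma a) (phi a) x v.

Definition dsigma a x v w : R := d_form1 (sigma_ a) x v w.

Definition dOmega a x u v w : R := d_form2 (h a) (Omega a) x u v w.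

Definition sigma_wedge_Omega a x u v w : R :=
  sg a x u * Omega a x v w + sg a x v * Omega a x w u + sg a x w * Omega a x u v.

(* {v_i; phi v_i; gamma} is an orthonormal basis of the tangent space. *)
Definition phi_frame a x (e : 'I_n -> V) : Prop :=
  orthonormal (h a x) (fun i : option ('I_n + 'I_n) =>
    match i with
    | Some (inl i) => e i
    | Some (inr i) => e i *m phi a x
    | None => gamma a x
    end).

Definition delta_sigma a x : R := - divergence (h a) (gamma a) x.

(* delta Omega computed in the frame {e_i; phi e_i; gamma}. *)
Definition delta_Omega a x (e : 'I_n -> V) v : R :=
  ip (h a x) (- (nabla (h a) (gamma a) (gamma a) x *m phi a x)
              + \sum_(i < n) PN a x (e i) (e i)) v.

Definition normal_ac : Prop :=
  forall a x, cimg a x -> forall v w,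
    nijenhuis (phi a) x v w + (2 * dsigma a x v w) *: gamma a x = 0.

Definition alpha_contact_with (alpha : R) : Prop :=
  forall a x, cimg a x -> forall v w,
    dsigma a x v w = alpha * Omega a x v w.

Definition alpha_contact : Prop :=
  exists alpha : R, alpha != 0 /\ alpha_contact_with alpha.

Definition quasi_contact : Prop :=
  forall a x, cimg a x -> forall v w,
    PN a x v w = (2 * ip (h a x) v w) *: gamma a x
      - sg a x w *: (v + sg a x v *: gamma a x + hN a x v).

Definition quasi_K_sasakian : Prop :=
  forall a x, cimg a x -> forall v w,
    PN a x v w = (2 * ip (h a x) v w) *: gamma a x - (2 * sg a x w) *: v
      + sg a x w *: nablagamma a x (v *m phi a x).

Definition strongly_pseudoconvex_CR : Prop :=
  alpha_contact_with 1 /\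
  forall a x, cimg a x -> forall v w,
    nablaphi a x v w = ip (h a x) (v + hN a x v) w *: gamma a x
      - sg a x w *: (v + hN a x v).

Definition alpha_sasakian : Prop := alpha_contact /\ normal_ac.

Definition class_A1 : Prop :=
  alpha_contact \/ quasi_contact \/ quasi_K_sasakian \/
  strongly_pseudoconvex_CR \/ alpha_sasakian.

Definition trans_sasakian (wp theta : N -> R) : Prop :=
  [/\ normal_ac,
      forall a x, cimg a x -> forall v w,
        nablaphi a x v w =
          wp (chart_inv a x) *: (ip (h a x) v w *: gamma a x - sg a x w *: v)
          + theta (chart_inv a x) *:
              (ip (h a x) (v *m phi a x) w *: gamma a x
               - sg a x w *: (v *m phi a x)),
      forall a x, cimg a x -> forall e, phi_frame a x e ->
        n.*2%:R * wp (chart_inv a x) = delta_Omega a x e (gamma a x) &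
      forall a x, cimg a x ->
        n.*2%:R * theta (chart_inv a x) = - delta_sigma a x].

Definition class_A3 : Prop :=
  exists wp theta : N -> R,
    [/\ smooth_fun wp, smooth_fun theta,
        forall p, wp p != 0, forall p, theta p != 0 & trans_sasakian wp theta].

Definition sigma_form1 a x : form R n.*2.+1 1 := fun e => sg a x (e ord0).

Definition dsigma_form2 a x : form R n.*2.+1 2 :=
  fun e => dsigma a x (e ord0) (e ord_max).

(* The condition on sigma /\ (d sigma)^r is pointwise: it vanishes nowhere. *)
Definition almost_quasi_sasakian : Prop :=
  (forall a x, cimg a x -> forall u v w, dOmega a x u v w = 0) /\
  exists r : nat, (1 <= r <= n.-1)%N /\
    forall a x, cimg a x ->
      (exists e, wedge (sigma_form1 a x) (wedge_pow (dsigma_form2 a x) r) e != 0)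
      /\ (forall e, wedge_pow (dsigma_form2 a x) r.+1 e = 0).

Definition class_A4a : Prop := almost_quasi_sasakian.

Definition almost_cosymplectic : Prop :=
  forall a x, cimg a x ->
    (forall v w, dsigma a x v w = 0) /\
    (forall u v w, dOmega a x u v w = 0).

Definition cosymplectic : Prop := almost_cosymplectic /\ normal_ac.

Definition nearly_cosymplectic : Prop :=
  forall a x, cimg a x -> forall v, nablaphi a x v v = 0.

Definition nearly_K_cosymplectic : Prop :=
  nearly_cosymplectic /\
  forall a x, cimg a x -> forall v, nablaphi a x v (gamma a x) = 0.

Definition quasi_K_cosymplectic : Prop :=
  forall a x, cimg a x -> forall v w,
    PN a x v w = sg a x w *: nablagamma a x (v *m phi a x).

Definition class_B1 : Prop :=
  cosymplectic \/ almost_cosymplectic \/ nearly_cosymplectic \/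
  nearly_K_cosymplectic \/ quasi_K_cosymplectic.

Definition semi_cosymplectic : Prop :=
  [/\ forall a x, cimg a x -> delta_sigma a x = 0,
      forall a x, cimg a x -> forall e, phi_frame a x e ->
        forall v, delta_Omega a x e v = 0 &
      normal_ac].

Definition class_B2 : Prop := semi_cosymplectic.

Definition d_fun (f : N -> R) a x v : R := 'D_v (f \o chart_inv a) x.

Definition almost_kenmotsu_with (beta : N -> R) : Prop :=
  [/\ smooth_fun beta,
      forall p, beta p != 0 &
      forall a x, cimg a x ->
        [/\ forall u v w, dOmega a x u v w =
              2 * beta (chart_inv a x) * sigma_wedge_Omega a x u v w,
            forall v w, dsigma a x v w = 0 &
            forall v w, d_fun beta a x v * sg a x w
                        - d_fun beta a x w * sg a x v = 0]].

Definition kenmotsu_with (beta : N -> R) : Prop :=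
  almost_kenmotsu_with beta /\ normal_ac.

Definition CR_kenmotsu_with (beta : N -> R) : Prop :=
  almost_kenmotsu_with beta /\
  forall a x, cimg a x -> forall v w,
    nablaphi a x v w =
      ip (h a x) (hN a x v) w *: gamma a x - sg a x w *: hN a x v
      + beta (chart_inv a x) *:
          (ip (h a x) (v *m phi a x) w *: gamma a x
           - sg a x w *: (v *m phi a x)).

Definition class_B3 : Prop :=
  exists beta : N -> R,
    almost_kenmotsu_with beta \/ kenmotsu_with beta \/ CR_kenmotsu_with beta.

End AlmostContact.

Section RiemannianMaps.
Variables (R : realType) (n k : nat) (M : riemannian R n) (N : riemannian R k).
Implicit Types (f : M -> N) (a : atlas M) (b : atlas N).

(* df at the point of chart coordinate x, in the charts a and b. *)
Definition push f a b (x v : 'rV[R]_n) : 'rV[R]_k := 'D_v (local_rep f a b) x.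

(* second fundamental form: nabla^f_v (df w) - df (nabla_v w) *)
Definition second_fundamental_form f a b (x v w : 'rV[R]_n) : 'rV[R]_k :=
  'D_v (fun y => push f a b y w) x
  + christoffel (metric b) (local_rep f a b x) (push f a b x v) (push f a b x w)
  - push f a b x (nabla (metric a) (cst v) (cst w) x).

Definition tension_field f a b (x : 'rV[R]_n) : 'rV[R]_k :=
  \sum_(i < n) \sum_(j < n) invmx (metric a x) i j *:
    second_fundamental_form f a b x (basis_vec R i) (basis_vec R j).

Definition harmonic_map f : Prop :=
  forall a b x, local_dom f a b x -> tension_field f a b x = 0.

Definition weakly_conformal f : Prop :=
  exists mu : M -> R, (forall p, 0 <= mu p) /\
    forall a b x, local_dom f a b x -> forall v w,
      ip (metric b (local_rep f a b x)) (push f a b x v) (push f a b x w)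
      = mu (chart_inv a x) ^+ 2 * ip (metric a x) v w.

(* df J = psi df or df J = - psi df, with one sign on the whole of M. *)
Definition pm_holomorphic (J : atlas M -> 'rV[R]_n -> 'M[R]_n)
    (psi : atlas N -> 'rV[R]_k -> 'M[R]_k) f : Prop :=
  exists s : bool, forall a b x, local_dom f a b x -> forall v,
    push f a b x (v *m J a x)
    = (-1) ^+ s *: (push f a b x v *m psi b (local_rep f a b x)).

Definition constant_map f : Prop := forall p q, f p = f q.

End RiemannianMaps.

Definition pluriharmonic_map (R : realType) (m k : nat) (H : almost_hermitian R m)
    (N : riemannian R k) (f : H -> N) : Prop :=
  forall (a : atlas H) (b : atlas N) x, local_dom f a b x -> forall v,
    second_fundamental_form f a b x v v
    + second_fundamental_form f a b x (v *m J_ a x) (v *m J_ a x) = 0.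

(* Main.v *)
(* Differentiating f_* J = s psi f_* (s = 1 or -1) gives, for T the second
   fundamental form,
     T(u,Jw) + f_*((nabla_u J)w) = s((nabla_{f_* u} psi) f_* w + psi T(u,w)).
   Since psi^2 = -1 + sigma (x) gamma and f_* is horizontal, two applications
   and the symmetry of T yield, with X = f_* v,
     T(v,v) + T(Jv,Jv) = Q(X) - f_* S(Jv,v),
     Q(X) = (nabla_{psi X} psi)X - (nabla_X psi)(psi X) = P(psi X,X).
   The S-terms vanish on a C_1 source and sum to 0 on a C_2 source, so everything
   is decided by Q on horizontal vectors.  Q = 0 for the targets of (i); an
   alpha-contact target even forces f_* = 0, because the symmetry of T makes
   d sigma vanish on the image of f_*.  On the targets of (ii),
   Q(X) = -2c|X|^2 gamma with c nowhere zero, so that the tension field vanishes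
   only if f_* = 0.  In (iii) f maps a J-frame to a multiple of a phi-frame, over
   which Q sums to -nabla_gamma gamma - (div gamma) gamma = 0. *)
Require Import Defs.
From HB Require Import structures.
From mathcomp Require Import all_boot all_order all_algebra all_fingroup.
From mathcomp Require Import all_classical all_reals all_analysis ring lra.

Set Implicit Arguments.
Unset Strict Implicit.
Unset Printing Implicit Defensive.

Import Order.TTheory GRing.Theory Num.Theory.
Import numFieldNormedType.Exports.

Local Open Scope classical_set_scope.
Local Open Scope ring_scope.

(** * Symmetry of second derivatives and matrix calculus *)

(** At a single point everything is linear algebra in the 1-jet of the structure. [structure_jet]
    records the differentiated identities, with [ga = 0] in the Hermitian case, so one argument
    serves the source and both kinds of target, and S(Jv,v) and Q become the same expression
    [defect]. The symmetry of T exchanges second derivatives of the local representatives, hence the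
    Schwarz theorem at the start. When d Omega = 2b sigma /\ Omega, Q is found by components: the
    horizontal part vanishes because psi anticommutes with its covariant derivative modulo gamma,
    and the gamma part is d Omega(X, psi X, gamma). So c is b, with b = 0 for closed forms; in the
    trans-Sasakian case c is theta. A vanishing differential gives only local constancy;
    connectedness of the source does the rest. In (iii) normality makes the integral curves of gamma
    geodesics, after which delta Omega = 0 says that P(e_i,e_i) sums to 0 over a phi-frame and delta
    sigma = 0 removes the divergence. *)

Section DirectionalDerivatives.
Variables (R : realType) (V : normedModType R).

Lemma is_derive_line (W : normedModType R) (f : V -> W) (x u : V) (a : R) (l : W) :
  is_derive (x + a *: u) u f l -> is_derive a 1 (fun t => f (x + t *: u)) l.
Proof.
have E : (fun t : R => t^-1 *: (((fun t => f (x + t *: u)) \o shift a) (t *: 1)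
      - f (x + a *: u))) =
    (fun t : R => t^-1 *: ((f \o shift (x + a *: u)) (t *: u) - f (x + a *: u))).
  apply/funext => t /=; congr (_ *: (f _ - _)).
  by rewrite [t *: 1]mulr1 scalerDl addrCA.
move=> [D1 D2]; split; first by rewrite /derivable E.
by rewrite /derive E.
Qed.

Lemma MVT_line (f df : V -> R) (x u : V) (t : R) : 0 < t ->
  (forall a, 0 <= a <= t -> is_derive (x + a *: u) u f (df (x + a *: u))) ->
  exists2 a, 0 <= a <= t & f (x + t *: u) - f x = df (x + a *: u) * t.
Proof.
move=> t0 dfP.
have D a : 0 <= a <= t ->
    is_derive a 1 (fun t => f (x + t *: u)) (df (x + a *: u)).
  by move=> /dfP; exact: is_derive_line.
have [||c] := @MVT _ (fun t => f (x + t *: u)) (fun a => df (x + a *: u)) 0 t t0.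
- by move=> a; rewrite in_itv/= => /andP[/ltW a0 /ltW at1]; apply: D; rewrite a0.
- apply: derivable_within_continuous => a; rewrite in_itv/= => aI.
  by have [] := D _ aI.
rewrite in_itv/= => /andP[/ltW c0 /ltW ct]; rewrite scale0r addr0 subr0 => E.
by exists c => //; rewrite c0.
Qed.

(** Two applications of the mean value theorem: along u to the increment y |-> f(y + tv) - f(y),
    then along v to [fu]. *)
Lemma second_difference (f fu fuv : V -> R) (x u v : V) (t : R) : 0 < t ->
  (forall a b, 0 <= a <= t -> 0 <= b <= t ->
     is_derive (x + a *: u + b *: v) u f (fu (x + a *: u + b *: v)) /\
     is_derive (x + a *: u + b *: v) v fu (fuv (x + a *: u + b *: v))) ->
  exists a b, [/\ 0 <= a <= t, 0 <= b <= t &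
    f (x + t *: u + t *: v) - f (x + t *: u) - f (x + t *: v) + f x =
    fuv (x + a *: u + b *: v) * t ^+ 2].
Proof.
move=> t0 fP.
have tI : 0 <= t <= t by rewrite (ltW t0) lexx.
have zI : 0 <= (0 : R) <= t by rewrite (ltW t0) lexx.
pose G y := f (y + t *: v) - f y.
have [|a aI aE] := @MVT_line G (fun y => fu (y + t *: v) - fu y) x u t t0.
  move=> a aI; apply: is_deriveB.
    have [D _] := fP a t aI tI.
    have E : (fun y => f (y + t *: v)) = f \o shift (t *: v) by [].
    have Es : (fun h : R => h^-1 *: (((f \o shift (t *: v)) \o shift (x + a *: u))
        (h *: u) - (f \o shift (t *: v)) (x + a *: u))) =
      (fun h : R => h^-1 *: ((f \o shift (x + a *: u + t *: v)) (h *: u)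
        - f (x + a *: u + t *: v))).
      by apply/funext => h /=; rewrite -!addrA.
    by case: D => D1 D2; rewrite E; split; rewrite /derivable /derive Es.
  by have [] := fP a 0 aI zI; rewrite scale0r addr0.
have [|b bI bE] := @MVT_line fu fuv (x + a *: u) v t t0.
  by move=> b bI; have [] := fP a b aI bI.
exists a, b; split => //.
rewrite expr2 mulrA -bE -aE /G; ring.
Qed.

(* The mixed second difference over a small square equals both mixed
   derivatives, each evaluated somewhere in the square. *)
Lemma schwarz_scalar (f fu fv fuv fvu : V -> R) (U : set V) (x u v : V) :
  open U -> U x ->
  (forall y, U y -> is_derive y u f (fu y)) ->
  (forall y, U y -> is_derive y v f (fv y)) ->
  (forall y, U y -> is_derive y v fu (fuv y)) ->
  (forall y, U y -> is_derive y u fv (fvu y)) ->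
  {for x, continuous fuv} -> {for x, continuous fvu} -> fuv x = fvu x.
Proof.
move=> oU Ux fuP fvP fuvP fvuP cuv cvu.
apply/eqP; rewrite -subr_eq0 -normr_le0; apply/ler_addgt0Pr => e e0.
rewrite add0r.
have e2 : 0 < e / 2 by rewrite divr_gt0.
have nU : \forall y \near x, [/\ U y, `|fuv x - fuv y| < e / 2 & `|fvu x - fvu y| < e / 2].
  near=> y; split; near: y; first exact: open_nbhs_nbhs.
    by apply: (@cvgr_dist_lt _ _ _ (nbhs x) _ fuv _ cuv).
  by apply: (@cvgr_dist_lt _ _ _ (nbhs x) _ fvu _ cvu).
have [r /= r0 rP] := (nbhs_ballP x _).1 nU.
(* The summand 1 keeps k positive when u = v = 0; [t * k < r] then keeps the whole parallelogram
   inside the ball. *)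
pose k : R := `|u| + `|v| + 1.
have k0 : 0 < k by rewrite /k -addrA ltr_wpDl// ltr_wpDl.
pose t := r / (2 * k).
have t0 : 0 < t by rewrite /t divr_gt0// mulr_gt0.
have tk : t * k < r.
  by rewrite /t invfM mulrA divfK ?gt_eqF//; lra.
have inb (w z : V) a b : `|w| + `|z| = `|u| + `|v| ->
    0 <= a <= t -> 0 <= b <= t -> ball x r (x + a *: w + b *: z).
  move=> wz /andP[a0 ta] /andP[b0 tb].
  rewrite -ball_normE /= -addrA opprD addNKr normrN.
  apply: le_lt_trans tk; apply: le_trans (ler_normD _ _) _.
  rewrite !normrZ (ger0_norm a0) (ger0_norm b0) /k -wz -addrA mulrDr mulrDr.
  rewrite mulr1 lerD ?ler_wpM2r//.
  by rewrite -[leLHS]addr0 lerD ?ler_wpM2r// ltW.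
have [|a [b [aI bI E1]]] := @second_difference f fu fuv x u v t t0.
  move=> a b aI bI; have [yU _ _] := rP _ (inb u v a b erefl aI bI).
  by split; [exact: fuP|exact: fuvP].
have [|c [d [cI dI E2]]] := @second_difference f fv fvu x v u t t0.
  move=> a' b' aI' bI'.
  have [yU _ _] := rP _ (inb v u a' b' (addrC _ _) aI' bI').
  by split; [exact: fvP|exact: fvuP].
have [_ h1 _] := rP _ (inb u v a b erefl aI bI).
have [_ _ h2] := rP _ (inb v u c d (addrC _ _) cI dI).
have E : fuv (x + a *: u + b *: v) = fvu (x + c *: v + d *: u).
  apply: (mulIf (x := t ^+ 2)); first by rewrite expf_neq0// gt_eqF.
  rewrite -E1 -E2 [x + t *: u + t *: v]addrAC; ring.
rewrite (splitr e) -(subrK (fuv (x + a *: u + b *: v)) (fuv x)) -addrA.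
apply: le_trans (ler_normD _ _) _; rewrite lerD ?ltW//.
by rewrite E distrC.
Unshelve. all: by end_near. Qed.

End DirectionalDerivatives.

Section MatrixCalculus.
Variables (R : realType) (V : normedModType R).

Lemma is_derive_coord (m n : nat) (A : V -> 'M[R]_(m, n)) (x u : V) l i j :
  is_derive x u A l -> is_derive x u (fun y => A y i j) (l i j).
Proof.
move=> [D <-]; split; first by move/derivable_mxP : D; exact.
by rewrite derive_mx// mxE.
Qed.

Lemma differentiable_mx (m n : nat) (A : V -> 'M[R]_(m, n)) (x : V) :
  (forall i j, differentiable (fun y => A y i j) x) -> differentiable A x.
Proof.
move=> dA.
have -> : A = \sum_(i < m) \sum_(j < n) (fun y => A y i j *: delta_mx i j).
  apply/funext => y; rewrite {1}[A y]matrix_sum_delta fct_sumE.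
  by apply: eq_bigr => i _; rewrite fct_sumE.
apply: differentiable_sum => i; apply: differentiable_sum => j.
exact: differentiableZl.
Qed.

Lemma differentiable_entry (m n : nat) (A : V -> 'M[R]_(m, n)) (x : V) i j :
  differentiable A x -> differentiable (fun y => A y i j) x.
Proof.
move=> dA; apply: (@differentiable_comp _ _ _ _ A (fun B : 'M[R]_(m, n) => B i j)) => //.
exact: differentiable_coord.
Qed.

Lemma differentiable_mulmx (m n p : nat) (A : V -> 'M[R]_(m, n))
    (B : V -> 'M[R]_(n, p)) (x : V) :
  differentiable A x -> differentiable B x ->
  differentiable (fun y => A y *m B y) x.
Proof.
move=> dA dB; apply: differentiable_mx => i j.
have -> : (fun y => (A y *m B y) i j) =
    \sum_(k < n) ((fun y => A y i k) * (fun y => B y k j)).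
  by apply/funext => y; rewrite mxE fct_sumE.
by apply: differentiable_sum => k; apply: differentiableM;
  exact: differentiable_entry.
Qed.

Lemma derive_mulmx (m n p : nat) (A : V -> 'M[R]_(m, n))
    (B : V -> 'M[R]_(n, p)) (x u : V) :
  differentiable A x -> differentiable B x ->
  'D_u (fun y => A y *m B y) x = 'D_u A x *m B x + A x *m 'D_u B x.
Proof.
move=> dA dB; have dAB := differentiable_mulmx dA dB.
have dv (W : normedModType R) (f : V -> W) :
  differentiable f x -> derivable f x u by exact: diff_derivable.
rewrite (derive_mx (dv _ _ dA)) (derive_mx (dv _ _ dB)) (derive_mx (dv _ _ dAB)).
apply/matrixP => i j; rewrite !mxE -big_split /=.
have -> : (fun y => (A y *m B y) i j) =
    \sum_(k < n) ((fun y => A y i k) * (fun y => B y k j)).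
  by apply/funext => y; rewrite mxE fct_sumE.
rewrite derive_sum => [|k]; last first.
  by apply: derivableM; apply: dv; exact: differentiable_entry.
apply: eq_bigr => k _; rewrite !mxE deriveM; last 2 first.
- by apply: dv; exact: differentiable_entry.
- by apply: dv; exact: differentiable_entry.
by rewrite addrC; congr (_ + _); rewrite [LHS]mulrC.
Qed.

Lemma differentiable_mulmxl (m n p : nat) (w : 'M[R]_(m, n))
    (B : V -> 'M[R]_(n, p)) (x : V) :
  differentiable B x -> differentiable (fun y => w *m B y) x.
Proof. by move=> dB; apply: differentiable_mulmx => //; exact: differentiable_cst. Qed.

Lemma derive_mulmxl (m n p : nat) (w : 'M[R]_(m, n))
    (B : V -> 'M[R]_(n, p)) (x u : V) :
  differentiable B x -> 'D_u (fun y => w *m B y) x = w *m 'D_u B x.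
Proof.
move=> dB; rewrite (derive_mulmx _ (differentiable_cst w x))//.
by rewrite derive_cst mul0mx add0r.
Qed.

Lemma derive_dirD (W : normedModType R) (f : V -> W) (x u v : V) :
  differentiable f x -> 'D_(u + v) f x = 'D_u f x + 'D_v f x.
Proof. by move=> df; rewrite !deriveE// linearD. Qed.

Lemma derive_dirZ (W : normedModType R) (f : V -> W) (x u : V) (k : R) :
  differentiable f x -> 'D_(k *: u) f x = k *: 'D_u f x.
Proof. by move=> df; rewrite !deriveE// linearZ. Qed.

Lemma derive_chain (W Z : normedModType R) (f : V -> W) (g : W -> Z) (x u : V) :
  differentiable f x -> differentiable g (f x) ->
  'D_u (g \o f) x = 'D_('D_u f x) g (f x).
Proof.
move=> df dg; have dgf : differentiable (g \o f) x by exact: differentiable_comp.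
by rewrite !deriveE// diff_comp.
Qed.

End MatrixCalculus.

Section Smooth.
Variables (R : realType) (n : nat).
Local Notation V := 'rV[R]_n.

Lemma smooth_differentiable (W : normedModType R) (U : set V) (f : V -> W) x :
  smooth_on U f -> U x -> differentiable f x.
Proof. by move=> /(_ 1%N)[+ _]; exact. Qed.

Lemma smooth_derive (W : normedModType R) (U : set V) (f : V -> W) v :
  smooth_on U f -> smooth_on U (fun y => 'D_v f y).
Proof. by move=> sf k; have [_] := sf k.+1; exact. Qed.

(** The mean value theorem is scalar, so the Schwarz argument runs coordinate by coordinate. *)
Lemma derive_swap (q : nat) (U : set V) (f : V -> 'rV[R]_q) (x u v : V) :
  open U -> smooth_on U f -> U x ->
  'D_u (fun y => 'D_v f y) x = 'D_v (fun y => 'D_u f y) x.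
Proof.
move=> oU sf Ux; apply/rowP => j.
have su := smooth_derive u sf; have sv := smooth_derive v sf.
have isd (h : V -> 'rV[R]_q) w y : smooth_on U h -> U y ->
    is_derive y w (fun y => h y 0 j) ('D_w h y 0 j).
  move=> sh Uy; apply: is_derive_coord; apply/derivableP/diff_derivable.
  exact: smooth_differentiable Uy.
have co (h : V -> 'rV[R]_q) : smooth_on U h -> {for x, continuous (fun y => h y 0 j)}.
  move=> sh; apply: differentiable_continuous.
  by apply: differentiable_entry; exact: smooth_differentiable Ux.
apply: (@schwarz_scalar _ _ (fun y => f y 0 j) (fun y => 'D_v f y 0 j)
  (fun y => 'D_u f y 0 j) (fun y => 'D_u (fun y => 'D_v f y) y 0 j)
  (fun y => 'D_v (fun y => 'D_u f y) y 0 j) U x v u) => //.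
- by move=> y; exact: isd.
- by move=> y; exact: isd.
- by move=> y; exact: (isd (fun y => 'D_v f y)).
- by move=> y; exact: (isd (fun y => 'D_u f y)).
- exact: (co _ (smooth_derive u sv)).
- exact: (co _ (smooth_derive v su)).
Qed.

Lemma constant_of_derive0 (q : nat) (f : V -> 'rV[R]_q) (x : V) (r : R) :
  (forall y, ball x r y -> differentiable f y) ->
  (forall y, ball x r y -> forall v, 'D_v f y = 0) ->
  forall y, ball x r y -> f y = f x.
Proof.
move=> df d0 y xy; apply/rowP => j.
have [|a _] := @MVT_line _ _ (fun y => f y 0 j) (fun=> 0) x (y - x) 1 ltr01.
  move=> a /andP[a0 a1].
  have yb : ball x r (x + a *: (y - x)).
    move: xy; rewrite -!ball_normE /= opprD addNKr normrN.
    apply: le_lt_trans; rewrite normrZ (ger0_norm a0) distrC.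
    by rewrite ler_piMl.
  have E : 'D_(y - x) f (x + a *: (y - x)) 0 j = 0 by rewrite d0// mxE.
  rewrite -[X in is_derive _ _ _ X]/(0 : R) -[X in is_derive _ _ _ X]E.
  by apply: is_derive_coord; apply/derivableP/diff_derivable/df.
by rewrite mul0r scale1r [x + _]addrC subrK => /eqP; rewrite subr_eq0 => /eqP.
Qed.

End Smooth.

(** * The Levi-Civita connection in a chart *)

Section InnerProduct.
Variables (R : realType) (n : nat).
Implicit Types (B : 'M[R]_n) (v w : 'rV[R]_n).

Lemma ipDl B v1 v2 w : ip B (v1 + v2) w = ip B v1 w + ip B v2 w.
Proof. by rewrite /ip !mulmxDl mxE. Qed.

Lemma ipZl B k v w : ip B (k *: v) w = k * ip B v w.
Proof. by rewrite /ip -!scalemxAl mxE. Qed.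

Lemma ipDr B v w1 w2 : ip B v (w1 + w2) = ip B v w1 + ip B v w2.
Proof. by rewrite /ip linearD mulmxDr mxE. Qed.

Lemma ipZr B k v w : ip B v (k *: w) = k * ip B v w.
Proof. by rewrite /ip linearZ -scalemxAr mxE. Qed.

Lemma ipNl B v w : ip B (- v) w = - ip B v w.
Proof. by rewrite -scaleN1r ipZl mulN1r. Qed.

Lemma ipNr B v w : ip B v (- w) = - ip B v w.
Proof. by rewrite -scaleN1r ipZr mulN1r. Qed.

Lemma ip0l B w : ip B 0 w = 0.
Proof. by rewrite -(scale0r 0) ipZl mul0r. Qed.

Lemma ip0r B v : ip B v 0 = 0.
Proof. by rewrite -(scale0r 0) ipZr mul0r. Qed.

Definition pos_def B := forall v, v != 0 -> 0 < ip B v v.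

Lemma ip_ge0 B v : pos_def B -> 0 <= ip B v v.
Proof. by move=> pB; have [->|/pB/ltW//] := eqVneq v 0; rewrite ip0l. Qed.

Lemma ip_eq0 B v : pos_def B -> ip B v v = 0 -> v = 0.
Proof. by move=> pB; have [//|/pB] := eqVneq v 0; rewrite lt0r => /andP[/eqP]. Qed.

(** A row vector killed by B has square norm 0, so the kernel is trivial. *)
Lemma pos_def_unit B : pos_def B -> B \in unitmx.
Proof.
move=> pB; rewrite -row_free_unit; apply/row_freeP.
have : kermx B == 0.
  apply/eqP/row_matrixP => i; rewrite row0; apply: (ip_eq0 pB).
  rewrite /ip (_ : row i (kermx B) *m B = 0) ?mul0mx ?mxE//.
  by apply/sub_kermxP; exact: row_sub.
by rewrite kermx_eq0 => /row_freeP.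
Qed.

End InnerProduct.

Section Connection.
Variables (R : realType) (n : nat).
Local Notation V := 'rV[R]_n.
Variables (g : V -> 'M[R]_n) (x : V).
Hypothesis dg : differentiable g x.

(** Differentiability of g at x makes the derivative of g trilinear in the direction and both
    arguments; bilinearity of the Christoffel symbols is then pure algebra in q. *)
Lemma christoffel_trilinear : exists q : V -> V -> V -> R,
  [/\ forall v w, christoffel g x v w =
         (\row_l (2^-1 * (q v w (basis_vec R l) + q w v (basis_vec R l)
                          - q (basis_vec R l) v w))) *m invmx (g x),
      forall k u v w z, q (k *: u + v) w z = k * q u w z + q v w z,
      forall k u v w z, q u (k *: v + w) z = k * q u v z + q u w z &
      forall k u v w z, q u v (k *: w + z) = k * q u v w + q u v z].
Proof.
exists (fun u v w => ip ('D_u g x) v w); split => [v w|k u v w z|k u v w z|k u v w z].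
- congr (_ *m _); apply/rowP => l.
  by rewrite [LHS]mxE [RHS]mxE !(derive_ip _ _ _ dg).2.
- rewrite (derive_dirD (k *: u) v dg) (derive_dirZ u k dg) /ip.
  move: ('D_u g x) ('D_v g x) => Du Dv.
  by rewrite mulmxDr mulmxDl -scalemxAr -scalemxAl !mxE.
- by rewrite ipDl ipZl.
- by rewrite ipDr ipZr.
Qed.

Lemma christoffel_linearl w : linear (fun v => christoffel g x v w).
Proof.
have [q [E q1 q2 q3]] := christoffel_trilinear.
move=> k u v; rewrite !E scalemxAl -mulmxDl; congr (_ *m _); apply/rowP => l.
by rewrite !mxE q1 !q2; ring.
Qed.

Lemma christoffel_linearr v : linear (christoffel g x v).
Proof.
have [q [E q1 q2 q3]] := christoffel_trilinear.
move=> k u w; rewrite !E scalemxAl -mulmxDl; congr (_ *m _); apply/rowP => l.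
by rewrite !mxE q1 q2 q3; ring.
Qed.

Lemma christoffelDl u v w :
  christoffel g x (u + v) w = christoffel g x u w + christoffel g x v w.
Proof. by have := christoffel_linearl w 1 u v; rewrite !scale1r. Qed.

Lemma christoffelDr v w z :
  christoffel g x v (w + z) = christoffel g x v w + christoffel g x v z.
Proof. by have := christoffel_linearr v 1 w z; rewrite !scale1r. Qed.

Lemma christoffelZl k v w :
  christoffel g x (k *: v) w = k *: christoffel g x v w.
Proof.
have c0 : christoffel g x 0 w = 0.
  by have := christoffel_linearl w 1 0 0; rewrite !scale1r addr0 => /eqP;
    rewrite -subr_eq0 opprD addNKr oppr_eq0 => /eqP.
by have := christoffel_linearl w k v 0; rewrite c0 !addr0.
Qed.

Lemma christoffelZr v k w :
  christoffel g x v (k *: w) = k *: christoffel g x v w.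
Proof.
have c0 : christoffel g x v 0 = 0.
  by have := christoffel_linearr v 1 0 0; rewrite !scale1r addr0 => /eqP;
    rewrite -subr_eq0 opprD addNKr oppr_eq0 => /eqP.
by have := christoffel_linearr v k w 0; rewrite c0 !addr0.
Qed.

Lemma nabla_cst v w : nabla g (cst v) (cst w) x = christoffel g x v w.
Proof. by rewrite /nabla derive_cst add0r. Qed.

Lemma nabla_dirD (X : V -> V) u v : differentiable X x ->
  nabla g (cst (u + v)) X x = nabla g (cst u) X x + nabla g (cst v) X x.
Proof. by move=> dX; rewrite /nabla /= derive_dirD// christoffelDl addrACA. Qed.

Lemma nabla_dirZ (X : V -> V) k v : differentiable X x ->
  nabla g (cst (k *: v)) X x = k *: nabla g (cst v) X x.
Proof. by move=> dX; rewrite /nabla /= derive_dirZ// christoffelZl scalerDr. Qed.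

Lemma nabla_scale (c : V -> R) (X : V -> V) u :
  differentiable c x -> differentiable X x ->
  nabla g (cst u) (fun y => c y *: X y) x =
  'D_u c x *: X x + c x *: nabla g (cst u) X x.
Proof.
move=> dc dX; rewrite /nabla /= christoffelZr scalerDr addrA; congr (_ + _).
(* Viewing the scalar as a 1 x 1 matrix reduces the claim to the product rule for matrices. *)
pose C y : 'M[R]_1 := (c y)%:M.
have dC : differentiable C x.
  apply: differentiable_mx => i j; rewrite (_ : (fun y => _) = c)//.
  by apply/funext => y; rewrite mxE !ord1 mulr1n.
have -> : (fun y => c y *: X y) = (fun y => C y *m X y).
  by apply/funext => y; rewrite mul_scalar_mx.
rewrite derive_mulmx// mul_scalar_mx; congr (_ + _).
rewrite derive_mx; last exact: diff_derivable.
rewrite (_ : \matrix_(i, j) _ = ('D_u c x)%:M) ?mul_scalar_mx//.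
apply/matrixP => i j; rewrite !mxE !ord1 mulr1n.
by congr ('D_u _ x); apply/funext => y; rewrite mxE mulr1n.
Qed.

Lemma nabla_mulmx (A : V -> 'M[R]_n) (X : V -> V) u :
  differentiable A x -> differentiable X x ->
  nabla g (cst u) (fun y => X y *m A y) x =
  nabla_endo g A x u (X x) + nabla g (cst u) X x *m A x.
Proof.
move=> dA dX; rewrite /nabla_endo nabla_cst /nabla /= derive_mulmx//.
rewrite derive_mulmxl// mulmxDl.
by rewrite [RHS]addrACA addNr addr0 [RHS]addrC addrA.
Qed.

Hypothesis gsym : \near x, (g x)^T = g x.
Hypothesis gunit : g x \in unitmx.

Lemma christoffelC v w : christoffel g x v w = christoffel g x w v.
Proof.
apply/eqP; rewrite -subr_eq0 -!nabla_cst.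
by rewrite nabla_torsion_free// /lie /= !derive_cst subrr.
Qed.

Lemma derive_ip_christoffel u v w :
  ip ('D_u g x) v w =
  ip (g x) (christoffel g x u v) w + ip (g x) v (christoffel g x u w).
Proof.
by rewrite -(derive_ip u v w dg).2 nabla_metric// !nabla_cst.
Qed.

(** [nabla_metric] treats constant-coefficient fields; the product rule adds the derivatives of X
    and Y, which complete the Christoffel terms to covariant derivatives. *)
Lemma nabla_ip (X Y : V -> V) u : differentiable X x -> differentiable Y x ->
  'D_u (fun y => ip (g y) (X y) (Y y)) x =
  ip (g x) (nabla g (cst u) X x) (Y x) + ip (g x) (X x) (nabla g (cst u) Y x).
Proof.
move=> dX dY.
have dYT : differentiable (fun y => (Y y)^T) x.
  apply: differentiable_mx => i j.
  rewrite (_ : (fun y => _) = (fun y => Y y j i)); first exact: differentiable_entry.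
  by apply/funext => y; rewrite mxE.
have DYT : 'D_u (fun y => (Y y)^T) x = ('D_u Y x)^T.
  rewrite !derive_mx; try exact: diff_derivable.
  apply/matrixP => i j; rewrite !mxE; congr ('D_u _ x).
  by apply/funext => y; rewrite mxE.
have dXg : differentiable (fun y => X y *m g y) x by exact: differentiable_mulmx.
have -> : 'D_u (fun y => ip (g y) (X y) (Y y)) x =
    'D_u (fun y => X y *m g y *m (Y y)^T) x 0 0.
  rewrite [in RHS]derive_mx ?mxE//; apply: diff_derivable.
  exact: differentiable_mulmx.
rewrite derive_mulmx// derive_mulmx// DYT mulmxDl.
have addE (B C : 'M[R]_1) : (B + C) 0 0 = B 0 0 + C 0 0 by rewrite mxE.
rewrite !addE.
rewrite -[X in X + _ + _]/(ip (g x) ('D_u X x) (Y x)).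
rewrite -[X in _ + X + _]/(ip ('D_u g x) (X x) (Y x)).
rewrite -[X in _ + X]/(ip (g x) (X x) ('D_u Y x)).
rewrite derive_ip_christoffel /nabla /= ipDl ipDr; ring.
Qed.

End Connection.

Lemma add3ACA (Z : zmodType) (p q r p' q' r' : Z) :
  (p + p') + (q + q') - (r + r') = (p + q - r) + (p' + q' - r').
Proof. by rewrite opprD (addrACA p) [LHS]addrACA. Qed.

Section EndomorphismField.
Variables (R : realType) (n : nat).
Local Notation V := 'rV[R]_n.
Variables (g A : V -> 'M[R]_n) (x : V).
Hypotheses (dg : differentiable g x) (dA : differentiable A x).
Local Notation D := (nabla_endo g A x).

Lemma nabla_endoE v w : D v w =
  w *m 'D_v A x + christoffel g x v (w *m A x) - christoffel g x v w *m A x.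
Proof. by rewrite /nabla_endo nabla_cst /nabla /= derive_mulmxl. Qed.

Lemma nabla_endoDl u v w : D (u + v) w = D u w + D v w.
Proof.
rewrite !nabla_endoE derive_dirD// !christoffelDl// mulmxDr mulmxDl.
exact: add3ACA.
Qed.

Lemma nabla_endoZl k v w : D (k *: v) w = k *: D v w.
Proof.
by rewrite !nabla_endoE derive_dirZ// !christoffelZl// -scalemxAr -scalemxAl
  scalerBr scalerDr.
Qed.

Lemma nabla_endoDr u v w : D u (v + w) = D u v + D u w.
Proof.
rewrite !nabla_endoE !mulmxDl !christoffelDr// mulmxDl.
exact: add3ACA.
Qed.

Lemma nabla_endoZr k v w : D v (k *: w) = k *: D v w.
Proof.
by rewrite !nabla_endoE -!scalemxAl !christoffelZr// -scalemxAl scalerBr scalerDr.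
Qed.

Lemma nabla_endoNr v w : D v (- w) = - D v w.
Proof. by rewrite -scaleN1r nabla_endoZr scaleN1r. Qed.

End EndomorphismField.

(** * Pointwise algebra of almost contact metric structures *)

Section PointwiseAlgebra.
Variables (R : realType) (n : nat).
Local Notation V := 'rV[R]_n.

Lemma ip_inj (B : 'M[R]_n) (v w : V) :
  pos_def B -> (forall z, ip B z v = ip B z w) -> v = w.
Proof.
move=> pB E; apply/eqP; rewrite -subr_eq0; apply/eqP/(ip_eq0 pB).
by rewrite ipDr ipNr E subrr.
Qed.

(* The value of an almost contact metric structure at a point together with
   D u v = (nabla_u psi) v and N u = nabla_u ga.  Almost Hermitian structures
   are the case ga = 0, N = 0. *)
Record structure_jet (h psi : 'M[R]_n) (ga : V) (D : V -> V -> V) (N : V -> V) :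
  Prop := StructureJet {
  jet_sym : h^T = h;
  jet_pos : pos_def h;
  jet_sqr : forall v, v *m psi *m psi = - v + ip h v ga *: ga;
  jet_ga : ga *m psi = 0;
  jet_skew : forall v w, ip h (v *m psi) w = - ip h v (w *m psi);
  jet_Dl : forall k u v w, D (k *: u + v) w = k *: D u w + D v w;
  jet_Dr : forall k u v w, D u (k *: v + w) = k *: D u v + D u w;
  jet_Dskew : forall u v w, ip h (D u v) w = - ip h v (D u w);
  jet_Dsqr : forall u v, D u (v *m psi) + D u v *m psi =
    ip h v (N u) *: ga + ip h v ga *: N u;
  jet_Dga : forall u, D u ga = - (N u *m psi)
}.

(* For v orthogonal to ga this is P(psi v,v); on an almost Hermitian manifold
   it is S(Jv,v). *)
Definition defect (psi : 'M[R]_n) (D : V -> V -> V) (v : V) : V :=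
  D (v *m psi) v - D v (v *m psi).

Section Jet.
Variables (h psi : 'M[R]_n) (ga : V) (D : V -> V -> V) (N : V -> V).
Hypothesis jet : structure_jet h psi ga D N.
Implicit Types u v w x y z : V.

Let hC v w : ip h v w = ip h w v.
Proof. exact: (ip_sym v w (jet_sym jet)). Qed.

Lemma jetDl u v w : D (u + v) w = D u w + D v w.
Proof. by have := jet_Dl jet 1 u v w; rewrite !scale1r. Qed.

Lemma jetDr u v w : D u (v + w) = D u v + D u w.
Proof. by have := jet_Dr jet 1 u v w; rewrite !scale1r. Qed.

Lemma jet0l w : D 0 w = 0.
Proof. by apply: (addrI (D 0 w)); rewrite -jetDl !addr0. Qed.

Lemma jet0r u : D u 0 = 0.
Proof. by apply: (addrI (D u 0)); rewrite -jetDr !addr0. Qed.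

Lemma jetZl k u w : D (k *: u) w = k *: D u w.
Proof. by have := jet_Dl jet k u 0 w; rewrite jet0l !addr0. Qed.

Lemma jetZr k u w : D u (k *: w) = k *: D u w.
Proof. by have := jet_Dr jet k u w 0; rewrite jet0r !addr0. Qed.

Lemma jetNl u w : D (- u) w = - D u w.
Proof. by rewrite -scaleN1r jetZl scaleN1r. Qed.

Lemma jetNr u w : D u (- w) = - D u w.
Proof. by rewrite -scaleN1r jetZr scaleN1r. Qed.

Lemma ip_psi_ga v : ip h (v *m psi) ga = 0.
Proof. by rewrite (jet_skew jet) (jet_ga jet) ip0r oppr0. Qed.

Lemma sqr_ker v : ip h v ga = 0 -> v *m psi *m psi = - v.
Proof. by move=> s; rewrite (jet_sqr jet) s scale0r addr0. Qed.

Lemma ip_psi_psi v w : ip h v ga = 0 -> ip h (v *m psi) (w *m psi) = ip h v w.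
Proof. by move=> s; rewrite hC (jet_skew jet) sqr_ker// ipNr opprK hC. Qed.

Lemma ip_psi_self v : ip h v (v *m psi) = 0.
Proof. have := jet_skew jet v v; rewrite [LHS]hC; lra. Qed.

Lemma D_psi u v : D u (v *m psi) =
  - (D u v *m psi) + (ip h v (N u) *: ga + ip h v ga *: N u).
Proof. by rewrite -(jet_Dsqr jet) addrC addrK. Qed.

Lemma ip_D_swap u v w : ip h v (D u w) = - ip h w (D u v).
Proof. by rewrite hC (jet_Dskew jet). Qed.

(** On horizontal vectors the [ga]-terms of [jet_Dsqr] drop out, so [D u] anticommutes with psi
    modulo [ga]; skewness of psi absorbs the sign. *)
Lemma ip_D_psi u v w : ip h v ga = 0 -> ip h w ga = 0 ->
  ip h v (D u (w *m psi)) = ip h (v *m psi) (D u w).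
Proof.
move=> sv sw; rewrite D_psi sw scale0r addr0 ipDr ipNr ipZr sv mulr0 addr0.
by rewrite (jet_skew jet).
Qed.

Lemma ip_D_psi_self u v : ip h v ga = 0 -> ip h v (D u (v *m psi)) = 0.
Proof.
by move=> sv; have := ip_D_psi u sv sv; rewrite [RHS]ip_D_swap; lra.
Qed.

Lemma ip_D_ga u v : ip h ga (D u v) = ip h v (N u *m psi).
Proof. by rewrite ip_D_swap (jet_Dga jet) ipNr opprK. Qed.

(** This is the exterior derivative of the fundamental 2-form h(v, psi w): since h is parallel, the
    covariant derivative of that form along u is h(v, D u w). *)
Definition cyclic_D u v w : R :=
  ip h v (D u w) + ip h w (D v u) + ip h u (D w v).

(* The alternating sum of cyclic_D over (x,y,z), (x,y psi,z psi),
   (x psi,y,z psi) and (x psi,y psi,z) leaves twice the left-hand side. *)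
Lemma cyclic_D_quasi x y z :
  (forall u v w, ip h u ga = 0 -> ip h v ga = 0 -> ip h w ga = 0 ->
     cyclic_D u v w = 0) ->
  ip h x ga = 0 -> ip h y ga = 0 -> ip h z ga = 0 ->
  ip h y (D x z) + ip h (y *m psi) (D (x *m psi) z) = 0.
Proof.
move=> C sx sy sz; have [[px py] pz] := (ip_psi_ga x, ip_psi_ga y, ip_psi_ga z).
have := C _ _ _ sx sy sz; have := C _ _ _ sx py pz.
have := C _ _ _ px sy pz; have := C _ _ _ px py sz.
rewrite /cyclic_D.
rewrite (ip_D_psi _ py sz) sqr_ker// ipNl.
rewrite (ip_D_psi _ sy sz).
rewrite (ip_D_psi _ sz sx) (ip_D_psi _ pz sx) sqr_ker// ipNl.
rewrite (ip_D_psi _ px sy) sqr_ker// ipNl (ip_D_psi _ sx sy).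
lra.
Qed.

(** Moving D onto [ga] by skewness produces two of the three cyclic terms; the third, h(x, D ga (psi
    x)), is zero. *)
Lemma ip_ga_defect x : ip h x ga = 0 ->
  ip h ga (defect psi D x) = cyclic_D x (x *m psi) ga.
Proof.
move=> sx; rewrite /defect /cyclic_D ipDr ipNr !ip_D_ga ip_D_psi_self//.
rewrite (jet_Dga jet) ipNr; lra.
Qed.

(** The hypothesis is d Omega = 2b sigma /\ Omega. It is used with b = 0 for almost Kähler
    structures and closed Omega, and with b = beta for almost beta-Kenmotsu targets. *)
Lemma defect_cyclic (b : R) x :
  (forall u v w, cyclic_D u v w = 2 * b *
     (ip h u ga * ip h v (w *m psi) + ip h v ga * ip h w (u *m psi)
      + ip h w ga * ip h u (v *m psi))) ->
  ip h x ga = 0 -> defect psi D x = (- (2 * b * ip h x x)) *: ga.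
Proof.
move=> C sx; apply: (ip_inj (jet_pos jet)) => z.
have C0 u v w : ip h u ga = 0 -> ip h v ga = 0 -> ip h w ga = 0 ->
    cyclic_D u v w = 0.
  by move=> su sv sw; rewrite C su sv sw !mul0r !addr0 mulr0.
(* [cyclic_D_quasi] at (x, psi x, psi y), with D moved to the other argument by skewness. *)
have horizontal y : ip h (y *m psi) (defect psi D x) = 0.
  have := cyclic_D_quasi C0 sx (ip_psi_ga x) (ip_psi_ga y).
  rewrite /defect ipDr ipNr sqr_ker// ipNl.
  rewrite (ip_D_swap x (x *m psi)) (ip_D_swap (x *m psi) x); lra.
(* Splitting z on both sides of the equation makes the factor h(ga, ga) appear on each, which covers
   [ga = 0] as well as a unit [ga]. *)
have -> : z = - (z *m psi *m psi) + ip h z ga *: ga.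
  by rewrite (jet_sqr jet) opprD opprK -addrA addNr addr0.
rewrite !ipDl !ipNl horizontal !ipZl ip_ga_defect// C.
by rewrite !ipZr !ip_psi_ga sx (jet_ga jet) ip0r sqr_ker// ipNr; ring.
Qed.

(** Polarization makes D alternating, so the defect is -2 D x (psi x), which equals -2 h(x, N x) ga
    by [D_psi]. That coefficient vanishes because D ga x = - D x ga = psi (N x), while h(psi x, D ga
    x) = 0. *)
Lemma defect_nearly x : (forall v, D v v = 0) -> ip h x ga = 0 ->
  defect psi D x = 0.
Proof.
move=> D0 sx.
have P u v : D u v = - D v u.
  have := D0 (u + v); rewrite jetDl !jetDr !D0 add0r addr0 => /eqP.
  by rewrite addr_eq0 => /eqP.
have Nx : ip h x (N x) = 0.
  have E : D x ga = - (N x *m psi) by exact: (jet_Dga jet).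
  have : ip h (x *m psi) (D ga x) = 0.
    by rewrite ip_D_swap ip_D_psi_self// oppr0.
  rewrite P E opprK ip_psi_psi//.
have E : D x (x *m psi) = 0.
  by rewrite D_psi D0 mul0mx Nx sx !scale0r oppr0 !addr0.
by rewrite /defect P E oppr0 addr0.
Qed.

Lemma defectZ k v : defect psi D (k *: v) = k ^+ 2 *: defect psi D v.
Proof.
by rewrite /defect -scalemxAl !jetZl !jetZr !scalerA -scalerBr -expr2.
Qed.

(* The right-hand side is P(v,v) psi, corrected by a multiple of ga whose sum
   over a frame is the divergence of ga. *)
Lemma defect_P v : ip h v ga = 0 ->
  defect psi D v = (D v v + D (v *m psi) (v *m psi)) *m psi
    - (ip h v (N v) + ip h (v *m psi) (N (v *m psi))) *: ga.
Proof.
move=> sv; rewrite /defect; have E1 := jet_Dsqr jet v v.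
have := jet_Dsqr jet (v *m psi) (v *m psi).
rewrite ip_psi_ga sqr_ker// jetNr scale0r addr0 => E2.
move: E1; rewrite sv scale0r addr0 => E1.
rewrite mulmxDl scalerDl -E1 -E2.
move: (D (v *m psi) v) (D v (v *m psi)) (D v v *m psi) (D (v *m psi) _ *m psi) => a b c d.
by apply/rowP => j; rewrite !mxE; ring.
Qed.

End Jet.
End PointwiseAlgebra.

(** * Holomorphic maps at one point: F is the differential, T the second fundamental form, s the
    sign *)

Section PointwiseMaps.
Variables (R : realType) (p q : nat).
Variables (G J : 'M[R]_p) (DJ : 'rV[R]_p -> 'rV[R]_p -> 'rV[R]_p).
Variables (h psi : 'M[R]_q) (ga : 'rV[R]_q).
Variables (D : 'rV[R]_q -> 'rV[R]_q -> 'rV[R]_q) (N : 'rV[R]_q -> 'rV[R]_q).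
Hypothesis jetJ : structure_jet G J 0 DJ (fun=> 0).
Hypothesis jet : structure_jet h psi ga D N.
Variables (F : 'M[R]_(p, q)) (T : 'rV[R]_p -> 'rV[R]_p -> 'rV[R]_q) (s : R).
Hypothesis sgn : s * s = 1.
Implicit Types u v w : 'rV[R]_p.
Hypothesis TC : forall u v : 'rV[R]_p, T u v = T v u.
Hypothesis TN : forall u v : 'rV[R]_p, T u (- v) = - T u v.
Hypothesis FJ : forall v : 'rV[R]_p, v *m J *m F = s *: (v *m F *m psi).
Hypothesis TJ : forall u w : 'rV[R]_p, T u (w *m J) + DJ u w *m F =
  s *: (D (u *m F) (w *m F) + T u w *m psi).

Let sqrJ v : v *m J *m J = - v.
Proof. by rewrite (jet_sqr jetJ) scaler0 addr0. Qed.

(** Since J is invertible, F v is up to sign psi applied to F(J v), and the image of psi is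
    orthogonal to [ga]. *)
Lemma holo_horizontal v : ip h (v *m F) ga = 0.
Proof.
have -> : v = - (v *m J *m J) by rewrite sqrJ opprK.
rewrite mulNmx ipNl FJ ipZl.
by rewrite (jet_skew jet) (jet_ga jet) ip0r oppr0 mulr0 oppr0.
Qed.

Let sqrF v : v *m F *m psi *m psi = - (v *m F).
Proof. by apply: (sqr_ker jet); exact: holo_horizontal. Qed.

(** This is h(F w, ga) = 0 differentiated along u. It is read off from [TJ] at (u, J w): pairing
    with [ga] kills the psi-term and the horizontal DJ-term. *)
Lemma holo_sff_ga u w : ip h (T u w) ga = - ip h (w *m F) (N (u *m F)).
Proof.
have := TJ u (w *m J); rewrite sqrJ TN FJ (jetZr jet) => E.
have : ip h (- T u w + DJ u (w *m J) *m F) ga =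
    ip h (s *: (s *: D (u *m F) (w *m F *m psi) + T u (w *m J) *m psi)) ga.
  by rewrite E.
rewrite ipDl ipNl holo_horizontal addr0 scalerDr scalerA sgn scale1r ipDl !ipZl.
rewrite (ip_psi_ga jet) mulr0 addr0 (jet_Dskew jet) (jet_Dga jet) ipNr opprK.
rewrite -[RHS]opprK -(jet_skew jet) sqrF ipNl; lra.
Qed.

(* The symmetry of T forces d(sigma) to vanish on the image of F. *)
Lemma holo_closed u w : ip h (w *m F) (N (u *m F)) = ip h (u *m F) (N (w *m F)).
Proof. by apply: oppr_inj; rewrite -!holo_sff_ga TC. Qed.

(* Evaluate T (vJ, vJ) by applying TJ twice, using the symmetry of T in between. *)
Lemma holo_sff_sum v : T v v + T (v *m J) (v *m J) =
  defect psi D (v *m F) - defect J DJ v *m F.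
Proof.
pose X := v *m F.
have E1 : T v (v *m J) = s *: (D X X + T v v *m psi) - DJ v v *m F.
  by rewrite -TJ addrK.
have E2 : T (v *m J) (v *m J) =
    D (X *m psi) X + s *: (T v (v *m J) *m psi) - DJ (v *m J) v *m F.
  rewrite (TC v) -[LHS](addrK (DJ (v *m J) v *m F)) TJ FJ (jetZl jet) scalerDr.
  by rewrite scalerA sgn scale1r.
have E3 : DJ v v *m J = - DJ v (v *m J).
  by rewrite (D_psi jetJ) !scaler0 !addr0 opprK.
have E4 : T v v *m psi *m psi = - T v v - ip h X (N X) *: ga.
  by rewrite (jet_sqr jet) holo_sff_ga scaleNr.
have E5 : D X X *m psi = - D X (X *m psi) + ip h X (N X) *: ga.
  by rewrite (D_psi jet) holo_horizontal scale0r addr0 opprD opprK addrNK.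
rewrite E2 E1 mulmxBl -scalemxAl mulmxDl E4 E5 scalerBr scalerA sgn scale1r.
have -> : s *: (DJ v v *m F *m psi) = - (DJ v (v *m J) *m F).
  by rewrite -FJ E3 mulNmx.
rewrite /defect -/X opprK mulmxBl.
move: (T v v) (D (X *m psi) X) (D X _) (_ *: ga) (_ *m F) (_ *m F) => a b c d e f.
by apply/rowP => j; rewrite !mxE; ring.
Qed.

End PointwiseMaps.

(** * Structure fields and the second fundamental form in charts *)

Section StructureFields.
Variables (R : realType) (n : nat).
Local Notation V := 'rV[R]_n.

Lemma nabla_near_eq (g : V -> 'M[R]_n) (X Y : V -> V) (x u : V) :
  (\near x, X x = Y x) -> nabla g (cst u) X x = nabla g (cst u) Y x.
Proof.
move=> XY; rewrite /nabla /= (near_eq_derive u XY).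
by rewrite (nbhs_singleton XY).
Qed.

Lemma differentiable_ip (g : V -> 'M[R]_n) (X Y : V -> V) (x : V) :
  differentiable g x -> differentiable X x -> differentiable Y x ->
  differentiable (fun y => ip (g y) (X y) (Y y)) x.
Proof.
move=> dg dX dY; apply: differentiable_entry.
apply: differentiable_mulmx; first exact: differentiable_mulmx.
apply: differentiable_mx => i j.
rewrite (_ : (fun y => _) = (fun y => Y y j i)); first exact: differentiable_entry.
by apply/funext => y; rewrite mxE.
Qed.

Lemma nablaD (g : V -> 'M[R]_n) (X Y : V -> V) (x u : V) :
  differentiable g x -> differentiable X x -> differentiable Y x ->
  nabla g (cst u) (fun y => X y + Y y) x =
  nabla g (cst u) X x + nabla g (cst u) Y x.
Proof.
move=> dg dX dY; rewrite /nabla /= (christoffelDr dg).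
rewrite (_ : (fun y => _) = X + Y)//.
by rewrite (deriveD (diff_derivable dX) (diff_derivable dY)) addrACA.
Qed.

Variables (g psi : V -> 'M[R]_n) (ga : V -> V) (U : set V) (x : V).
Hypotheses (oU : open U) (Ux : U x).
Hypotheses (dg : differentiable g x) (dpsi : differentiable psi x)
  (dga : differentiable ga x).
Hypothesis gsym : forall y, U y -> (g y)^T = g y.
Hypothesis gpos : pos_def (g x).

Let nearU (P : V -> Prop) : (forall y, U y -> P y) -> \near x, P x.
Proof.
by move=> UP; apply: filterS (UP) _; exact: open_nbhs_nbhs.
Qed.

Let gU : \near x, (g x)^T = g x. Proof. exact: nearU. Qed.

Let gunit : g x \in unitmx. Proof. exact: pos_def_unit. Qed.

Lemma nabla_form2E u v w :
  nabla_form2 g (fun y v w => ip (g y) v (w *m psi y)) x u v w =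
  ip (g x) v (nabla_endo g psi x u w).
Proof.
have dc (z : V) : differentiable (cst z : V -> V) x by exact: differentiable_cst.
have dY : differentiable (fun y => w *m psi y) x by exact: differentiable_mulmxl.
rewrite /nabla_form2 (nabla_ip dg gU gunit u (dc v) dY) /=.
rewrite (nabla_mulmx g u dpsi (dc w)) ipDr; ring.
Qed.

(** For s metrically dual to [ga], the Christoffel terms cancel by symmetry and the antisymmetrized
    covariant derivative of [ga] remains. *)
Lemma d_form1E (s : V -> 'cV[R]_n) v w :
  (forall y, U y -> forall z, ev (s y) z = ip (g y) z (ga y)) ->
  d_form1 s x v w = 2^-1 * (ip (g x) w (nabla g (cst v) ga x)
                            - ip (g x) v (nabla g (cst w) ga x)).
Proof.
move=> sE.
have D (u z : V) : 'D_u (fun y => ev (s y) z) x =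
    ip (g x) (christoffel g x u z) (ga x) + ip (g x) z (nabla g (cst u) ga x).
  rewrite -nabla_cst -(nabla_ip dg gU gunit u (differentiable_cst z x) dga).
  by apply: near_eq_derive; apply: nearU => y Uy; exact: sE.
have lie0 : lie (cst v) (cst w) x = 0 by rewrite /lie !derive_cst subrr.
have ev0 : ev (s x) 0 = 0 by rewrite /ev mul0mx mxE.
rewrite /d_form1 /d_form1_vf lie0 /= !D (christoffelC gU w v) ev0.
move: (ip _ _ _) (ip _ w _) (ip _ v _) => a b c; ring.
Qed.

Hypothesis psi_sqr : forall y, U y -> forall v,
  v *m psi y *m psi y = - v + ip (g y) v (ga y) *: ga y.
Hypothesis psi_ga : forall y, U y -> ga y *m psi y = 0.
Hypothesis psi_skew : forall y, U y -> forall v w,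
  ip (g y) (v *m psi y) w = - ip (g y) v (w *m psi y).

(** The algebraic identities hold on all of U and can be differentiated at x: skewness of psi gives
    [jet_Dskew], the formula for psi^2 gives [jet_Dsqr], and psi ga = 0 gives [jet_Dga]. *)
Lemma field_jet : structure_jet (g x) (psi x) (ga x) (nabla_endo g psi x)
  (fun u => nabla g (cst u) ga x).
Proof.
have dc (v : V) : differentiable (cst v : V -> V) x by exact: differentiable_cst.
have dY (w : V) : differentiable (fun y => w *m psi y) x by exact: differentiable_mulmxl.
split => //.
- exact: gsym.
- by move=> v; exact: psi_sqr.
- exact: psi_ga.
- by move=> v w; exact: psi_skew.
- by move=> k u v w; rewrite nabla_endoDl// nabla_endoZl.
- by move=> k u v w; rewrite nabla_endoDr// nabla_endoZr.
- move=> u v w.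
  have E : \near x, ip (g x) (v *m psi x) (cst w x)
      = ip (g x) (cst v x) (- w *m psi x).
    by apply: nearU => y Uy; rewrite psi_skew//= mulNmx ipNr.
  have := near_eq_derive u E.
  rewrite (nabla_ip dg gU gunit u (dY v) (dc w)).
  rewrite (nabla_ip dg gU gunit u (dc v) (dY (- w))) /=.
  rewrite (nabla_mulmx g u dpsi (dc v)) (nabla_mulmx g u dpsi (dc (- w))).
  have -> : nabla_endo g psi x u (cst (- w) x) = - nabla_endo g psi x u w.
    exact: nabla_endoNr.
  rewrite !nabla_cst -[- w]scaleN1r (christoffelZr dg) !scaleN1r /cst.
  move: (nabla_endo _ _ _ _ v) (nabla_endo _ _ _ _ w) => a b.
  move: (christoffel _ _ _ v) (christoffel _ _ _ w) => c d.
  rewrite !mulNmx -opprD !ipNr ipDl ipDr !psi_skew//.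
  lra.
- move=> u v.
  have E : \near x, v *m psi x *m psi x = cst (- v) x + ip (g x) (cst v x) (ga x) *: ga x.
    by apply: nearU => y Uy; rewrite psi_sqr.
  have dip : differentiable (fun y => ip (g y) (cst v y) (ga y)) x.
    exact: differentiable_ip.
  have dZ : differentiable (fun y => ip (g y) (cst v y) (ga y) *: ga y) x.
    apply: differentiable_mx => i j.
    rewrite (_ : (fun y => _) = (fun y => ip (g y) (cst v y) (ga y)) *
      (fun y => ga y i j)); last by apply/funext => y; rewrite mxE.
    by apply: differentiableM => //; exact: differentiable_entry.
  have := nabla_near_eq g u E.
  rewrite (nabla_mulmx g u dpsi (dY v)) (nabla_mulmx g u dpsi (dc v)) /=.
  rewrite (nablaD u dg (dc (- v)) dZ) (nabla_scale dg u dip dga) /=.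
  rewrite (nabla_ip dg gU gunit u (dc v) dga) !nabla_cst /=.
  rewrite -[- v]scaleN1r (christoffelZr dg) !scaleN1r /cst.
  move: (nabla_endo _ _ _ _ (_ *m _)) (nabla_endo _ _ _ _ v) => a b.
  move: (christoffel _ _ _ _) (nabla _ _ _ _) => c d.
  rewrite mulmxDl psi_sqr// scalerDl => H.
  apply/rowP => j; have := congr1 (fun A : V => A 0 j) H.
  by rewrite !mxE; lra.
- move=> u; have E : \near x, ga x *m psi x = cst 0 x by exact: nearU.
  have := nabla_near_eq g u E.
  rewrite (nabla_mulmx g u dpsi dga) nabla_cst /=.
  rewrite -(scale0r 0) (christoffelZr dg) scale0r => /eqP.
  by rewrite addr_eq0 => /eqP.
Qed.

End StructureFields.

Section SecondFundamentalForm.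
Variables (R : realType) (p q : nat).
Local Notation V := 'rV[R]_p.
Local Notation W := 'rV[R]_q.
Variables (g J : V -> 'M[R]_p) (h psi : W -> 'M[R]_q) (F : V -> W).
Variables (U : set V) (x : V).
Hypotheses (oU : open U) (Ux : U x) (sF : smooth_on U F).
Hypotheses (dg : differentiable g x) (dh : differentiable h (F x)).

(** Stated for a map between vector spaces; convertible with [second_fundamental_form] when F is a
    local representative. *)
Definition sff (u w : V) : W :=
  'D_u (fun y => 'D_w F y) x
  + christoffel h (F x) ('D_u F x) ('D_w F x)
  - 'D_(nabla g (cst u) (cst w) x) F x.

Definition jac (y : V) : 'M[R]_(p, q) :=
  \matrix_(i, j) ('D_(delta_mx 0 i) F y) 0 j.

Lemma derive_jac (v y : V) : U y -> 'D_v F y = v *m jac y.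
Proof.
move=> Uy; have dF := smooth_differentiable sF Uy.
rewrite deriveEjacobian//; congr (_ *m _); apply/matrixP => i j.
by rewrite !mxE deriveE.
Qed.

Lemma differentiable_jac : differentiable jac x.
Proof.
apply: differentiable_mx => i j.
rewrite (_ : (fun y => _) = (fun y => 'D_(delta_mx 0 i) F y 0 j)); last first.
  by apply/funext => y; rewrite mxE.
apply: differentiable_entry.
exact: (smooth_differentiable (smooth_derive _ sF) Ux).
Qed.

Let nearU (P : V -> Prop) : (forall y, U y -> P y) -> \near x, P x.
Proof. by move=> UP; apply: filterS (UP) _; exact: open_nbhs_nbhs. Qed.

Lemma sffE u w : sff u w =
  w *m 'D_u jac x + christoffel h (F x) (u *m jac x) (w *m jac x)
  - christoffel g x u w *m jac x.
Proof.
rewrite /sff !derive_jac// nabla_cst; congr (_ + _ - _).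
rewrite -(derive_mulmxl w u differentiable_jac); apply: near_eq_derive.
by apply: nearU => y Uy; exact: derive_jac.
Qed.

Lemma sff_linearr u : linear (sff u).
Proof.
move=> k v w; rewrite !sffE.
rewrite (christoffelDr dg) (christoffelZr dg) !mulmxDl -!scalemxAl.
rewrite (christoffelDr dh) (christoffelZr dh) scalerBr scalerDr.
exact: add3ACA.
Qed.

Lemma sffC u w : (\near x, (g x)^T = g x) -> (\forall y \near F x, (h y)^T = h y) ->
  sff u w = sff w u.
Proof.
move=> gT hT; have S := derive_swap u w oU sF Ux.
have C := christoffelC hT ('D_u F x) ('D_w F x).
have E : 'D_(nabla g (cst u) (cst w) x) F x = 'D_(nabla g (cst w) (cst u) x) F x.
  by rewrite !nabla_cst (christoffelC gT u w).
exact: (f_equal3 (fun a b c : W => a + b - c) S C E).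
Qed.

(** The identity F J = s psi F is differentiated along u, with the chain rule for psi composed with
    F. Passing to covariant derivatives adds Christoffel terms of both metrics, which cancel by the
    undifferentiated identity. *)
Lemma sff_holo (s : R) :
  differentiable J x -> differentiable psi (F x) ->
  (forall y, U y -> forall v, 'D_(v *m J y) F y = s *: ('D_v F y *m psi (F y))) ->
  forall u w, sff u (w *m J x) + nabla_endo g J x u w *m jac x =
    s *: (nabla_endo h psi (F x) (u *m jac x) (w *m jac x) + sff u w *m psi (F x)).
Proof.
move=> dJ dpsi FJ u w; have dF := smooth_differentiable sF Ux.
have FJx (v : V) : v *m J x *m jac x = s *: (v *m jac x *m psi (F x)).
  by rewrite -!(derive_jac _ Ux) FJ.
have djac := differentiable_jac.
have dpsiF : differentiable (psi \o F) x by exact: differentiable_comp.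
have E : \near x, w *m J x *m jac x = (s *: w) *m jac x *m (psi \o F) x.
  by apply: nearU => y Uy; rewrite -!scalemxAl -!(derive_jac _ Uy) FJ.
have := near_eq_derive u E.
rewrite (derive_mulmx u (differentiable_mulmxl w dJ) djac).
rewrite (derive_mulmx u (differentiable_mulmxl _ djac) dpsiF).
rewrite (derive_mulmxl w u dJ) (derive_mulmxl _ u djac) (derive_chain u dF dpsi).
rewrite (derive_jac _ Ux) -!scalemxAl /= => DE.
rewrite !sffE nabla_endoE// nabla_endoE// FJx (christoffelZr dh) 2!mulmxBl.
rewrite [in LHS]mulmxDl FJx.
have := FJx (christoffel g x u w).
move: (christoffel g x u w) (christoffel g x u (w *m J x)) => a b.
move: (christoffel h _ _ _) (christoffel h _ _ _) => c d FJa.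
rewrite (mulmxDl (w *m 'D_u jac x) c); move: DE.
move: (w *m 'D_u J x *m jac x) (w *m J x *m 'D_u jac x) (b *m jac x) => e1 e2 e3.
move: (w *m 'D_u jac x *m psi (F x)) (w *m jac x *m 'D__ psi (F x)) => e4 e5.
move: (a *m jac x *m psi (F x)) (c *m psi (F x)) => e6 e7 DE.
apply/rowP => j; have := congr1 (fun A : W => A 0 j) DE.
by rewrite !mxE; lra.
Qed.

End SecondFundamentalForm.

(** * Orthonormal frames *)

Section Frames.
Variables (R : realType) (n : nat).
Local Notation V := 'rV[R]_n.

Section Basis.
Variables (B : 'M[R]_n) (I : finType) (e : I -> V).
Hypotheses (cardI : #|I| = n) (Be : Defs.orthonormal B e).

(** With the frame as rows of a square matrix E, orthonormality reads E B E^T = 1, whence B^-1 = E^T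
    E. *)
Lemma orthonormal_inv : invmx B = \sum_t (e t)^T *m e t.
Proof.
pose f (k : 'I_n) : I := enum_val (cast_ord (esym cardI) k).
have fbij : bijective f.
  apply: inj_card_bij; last by rewrite card_ord cardI.
  by move=> k l /enum_val_inj/cast_ord_inj.
pose E : 'M[R]_n := \matrix_k e (f k).
have EBE : E *m B *m E^T = 1%:M.
  apply/matrixP => k l; rewrite [RHS]mxE.
  have := Be (f k) (f l); rewrite (bij_eq fbij) => <-.
  rewrite /ip -(rowK (fun k => e (f k)) k) -(rowK (fun k => e (f k)) l) -/E.
  rewrite -row_mul tr_row [LHS]mxE [RHS]mxE; apply: eq_bigr => j _.
  by congr (_ * _); rewrite [RHS]mxE.
have BEE : B *m (E^T *m E) = 1%:M.
  by rewrite mulmxA; apply: mulmx1C; rewrite mulmxA.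
have [uB _] := mulmx1_unit BEE.
have -> : invmx B = E^T *m E.
  by rewrite -[RHS]mul1mx -(mulVmx uB) -mulmxA BEE mulmx1.
apply/matrixP => i j; rewrite mxE summxE (reindex f)/=; last exact: onW_bij.
by apply: eq_bigr => k _; rewrite !mxE big_ord1 !mxE.
Qed.

Lemma orthonormal_trace (L : 'M[R]_n) : B \in unitmx ->
  \tr L = \sum_t ip B (e t *m L) (e t).
Proof.
move=> uB; rewrite -[L in LHS](mulmxK uB) orthonormal_inv mulmx_sumr raddf_sum.
apply: eq_bigr => t _ /=; rewrite mulmxA mxtrace_mulC mulmxA [LHS]/mxtrace big_ord1.
by rewrite /ip mulmxA.
Qed.

Lemma orthonormal_expand v : B \in unitmx -> v = \sum_t ip B v (e t) *: e t.
Proof.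
move=> uB; rewrite -[LHS](mulmxK uB) orthonormal_inv mulmx_sumr.
apply: eq_bigr => t _; rewrite mulmxA [_ *m (e t)^T]mx11_scalar mul_scalar_mx.
by [].
Qed.

(** Turns the metric trace in the definition of the tension field into a sum over a frame. *)
Lemma orthonormal_contraction (q : nat) (T : V -> V -> 'rV[R]_q) :
  (forall u, linear (T u)) -> (forall u v, T u v = T v u) ->
  \sum_(i < n) \sum_(j < n) invmx B i j *: T (basis_vec R i) (basis_vec R j) =
  \sum_t T (e t) (e t).
Proof.
move=> Tl TC.
have T0 u : T u 0 = 0.
  by have := Tl u 1 0 0; rewrite !scale1r addr0 => /eqP;
    rewrite -subr_eq0 opprD addNKr oppr_eq0 => /eqP.
have Tsum u v : T u v = \sum_j v 0 j *: T u (basis_vec R j).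
  rewrite {1}[v]row_sum_delta.
  have : forall s, T u (\sum_(j <- s) v 0 j *: delta_mx 0 j) =
      \sum_(j <- s) v 0 j *: T u (basis_vec R j).
    elim=> [|j s IH]; first by rewrite !big_nil.
    by rewrite !big_cons Tl IH.
  exact.
have Tsuml u v : T u v = \sum_i u 0 i *: T (basis_vec R i) v.
  by rewrite TC Tsum; apply: eq_bigr => i _; rewrite TC.
rewrite orthonormal_inv.
transitivity (\sum_i \sum_j \sum_t
    (e t 0 i * e t 0 j) *: T (basis_vec R i) (basis_vec R j)).
  apply: eq_bigr => i _; apply: eq_bigr => j _.
  rewrite summxE scaler_suml; apply: eq_bigr => t _.
  by rewrite mxE big_ord1 mxE.
under eq_bigr do rewrite exchange_big; rewrite exchange_big /=.
apply: eq_bigr => t _; rewrite [RHS]Tsuml; apply: eq_bigr => i _.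
by rewrite Tsum scaler_sumr; apply: eq_bigr => j _; rewrite scalerA.
Qed.

End Basis.
End Frames.

Section HermitianFrame.
Variables (R : realType) (m : nat).
Local Notation V := 'rV[R]_(m.*2).
Variables (B J : 'M[R]_(m.*2)).
Hypotheses (Bsym : B^T = B) (Bpos : pos_def B).
Hypothesis JJ : J *m J = - 1%:M.
Hypothesis BJ : forall v w, ip B (v *m J) (w *m J) = ip B v w.

Lemma hermitian_skew v w : ip B (v *m J) w = - ip B v (w *m J).
Proof. by rewrite -BJ -mulmxA JJ mulmxN mulmx1 ipNl. Qed.

(** Dimension count: 2k linear conditions on a space of dimension 2m > 2k. *)
Lemma hermitian_orthogonal (k : nat) (e : nat -> V) : (k < m)%N ->
  exists2 v : V, v != 0 & forall i, (i < k)%N ->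
    ip B v (e i) = 0 /\ ip B v (e i *m J) = 0.
Proof.
move=> km.
pose A : 'M[R]_(m.*2, k + k) := row_mx (\matrix_(l, j) (B *m (e j)^T) l 0)
  (\matrix_(l, j) (B *m (e j *m J)^T) l 0).
have : kermx A != 0.
  rewrite -mxrank_eq0 mxrank_ker subn_eq0 -ltnNge.
  by apply: leq_ltn_trans (rank_leq_col _) _; rewrite addnn ltn_double.
move=> /rowV0Pn[v /sub_kermxP vA v0]; exists v => // i ik.
move: vA; rewrite mul_mx_row => vA.
have [vA1 vA2] : v *m (\matrix_(l, j) (B *m (e (j : 'I_k))^T) l 0) = 0 /\
    v *m (\matrix_(l, j) (B *m (e (j : 'I_k) *m J)^T) l 0) = 0.
  by apply: eq_row_mx; rewrite vA row_mx0.
split.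
  have := congr1 (fun C : 'rV[R]_k => C 0 (Ordinal ik)) vA1; rewrite !mxE => <-.
  by rewrite /ip -mulmxA mxE; apply: eq_bigr => l _; rewrite !mxE.
have := congr1 (fun C : 'rV[R]_k => C 0 (Ordinal ik)) vA2; rewrite !mxE => <-.
by rewrite /ip -mulmxA mxE; apply: eq_bigr => l _; rewrite !mxE.
Qed.

Lemma hermitian_frame_exists : exists e : 'I_m -> V,
  Defs.orthonormal B (fun i : 'I_m + 'I_m =>
    match i with inl i => e i | inr i => e i *m J end).
Proof.
have self v : ip B v (v *m J) = 0.
  by have := hermitian_skew v v; rewrite (ip_sym _ _ Bsym); lra.
(* Gram-Schmidt by J-invariant planes. Partial frames are functions on [nat], so that the induction
   step only redefines the value at k. *)
have step k : (k <= m)%N -> exists e : nat -> V, forall i j, (i < k)%N -> (j < k)%N ->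
    ip B (e i) (e j) = (i == j)%:R /\ ip B (e i) (e j *m J) = 0.
  elim: k => [_|k IH km]; first by exists (fun=> 0).
  have [e eP] := IH (ltnW km); have [v v0 vP] := hermitian_orthogonal e km.
  pose w := (Num.sqrt (ip B v v))^-1 *: v.
  have ww : ip B w w = 1.
    rewrite /w ipZl ipZr mulrA -expr2 exprVn sqr_sqrtr; last exact: ltW (Bpos v0).
    by rewrite mulVf// gt_eqF// Bpos.
  have we i : (i < k)%N -> ip B w (e i) = 0.
    by move=> /vP[E _]; rewrite /w ipZl E mulr0.
  have weJ i : (i < k)%N -> ip B w (e i *m J) = 0.
    by move=> /vP[_ E]; rewrite /w ipZl E mulr0.
  exists (fun i => if i == k then w else e i) => i j.
  rewrite !ltnS leq_eqVlt [(j <= k)%N]leq_eqVlt.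
  case: (eqVneq i k) => [->|ik] /= iP; case: (eqVneq j k) => [->|jk] /= jP.
  - by rewrite ww self.
  - by rewrite we// weJ// eq_sym (negPf jk).
  - rewrite (negPf ik) (ip_sym _ _ Bsym) we//; split=> //.
    by rewrite -[LHS]opprK -hermitian_skew (ip_sym _ _ Bsym) weJ// oppr0.
  - exact: eP.
have [e eP] := step m (leqnn m); exists (fun i => e i) => -[i|i] [j|j].
- by rewrite (eP i j _ _).1.
- by rewrite (eP i j _ _).2.
- by rewrite hermitian_skew (eP i j _ _).2// oppr0.
- by rewrite BJ (eP i j _ _).1.
Qed.

End HermitianFrame.

(** * Constant maps and jets of the given structures *)

Section Charts.
Variables (R : realType) (n k : nat) (M : manifold R n) (N : manifold R k).

Lemma open_local_dom (f : M -> N) a b : continuous f -> open (local_dom f a b).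
Proof.
move=> cf; rewrite openE => x [ax bx]; apply: filterI.
  by apply: open_nbhs_nbhs; split => //; exact: cimg_open.
have c : {for x, continuous (f \o chart_inv a)}.
  by apply: continuous_comp; [exact: chart_inv_continuous|exact: cf].
by apply: c; apply: open_nbhs_nbhs; split => //; exact: cdom_open.
Qed.

Lemma local_rep_img (f : M -> N) a b x :
  local_dom f a b x -> cimg b (local_rep f a b x).
Proof. by move=> [_ bx]; exists (f (chart_inv a x)). Qed.

End Charts.

Section ConstantMaps.
Variables (R : realType) (n k : nat) (M : riemannian R n) (N : riemannian R k).
Variable f : M -> N.
Hypothesis sf : smooth_map f.

Lemma locally_constant :
  (forall a b x, local_dom f a b x -> forall v, push f a b x v = 0) ->
  forall p, \forall q \near p, f q = f p.
Proof.
move=> f0 p; have [a ap] := cdom_cover p; have [b bp] := cdom_cover (f p).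
have ax : cimg a (chart a p) by exists p.
have dx : local_dom f a b (chart a p) by split => //=; rewrite chartK.
have [r /= r0 rP] : exists2 r : R, 0 < r & ball (chart a p) r `<=` local_dom f a b.
  apply/nbhs_ballP; apply: open_nbhs_nbhs; split => //.
  by apply: open_local_dom; case: sf.
have F y : ball (chart a p) r y -> local_rep f a b y = local_rep f a b (chart a p).
  apply: constant_of_derive0 => z zb; last by move=> v; apply: f0; exact: rP.
  by apply: (smooth_differentiable (sf.2 a b)); exact: rP.
have near1 : \forall q \near p, cdom a q.
  by apply: open_nbhs_nbhs; split => //; exact: cdom_open.
have near2 : \forall q \near p, ball (chart a p) r (chart a q).
  by apply: (chart_continuous ap); exact: nbhsx_ballx.
have near3 : \forall q \near p, cdom b (f q).
  by apply: sf.1; apply: open_nbhs_nbhs; split => //; exact: cdom_open.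
apply: filterS3 near1 near2 near3 => q aq /F + bq.
rewrite /local_rep /= !chartK// => E.
by rewrite -(chartK bq) E chartK.
Qed.

Lemma constant_of_push0 : connected [set: M] ->
  (forall a b x, local_dom f a b x -> forall v, push f a b x v = 0) ->
  constant_map f.
Proof.
move=> cM /locally_constant lc p q.
(* By local constancy the preimage of every set is open, so each fibre is both open and closed. *)
have op (A : set N) : open (f @^-1` A).
  rewrite openE => r Ar; apply: filterS (lc r) => z E.
  by rewrite /preimage /= E.
suff : [set r | f r = f q] = setT by move=> /seteqP[_]; exact.
apply: cM; first by exists q.
  exists (f @^-1` [set f q]); first exact: op.
  by rewrite setTI.
exists (f @^-1` [set f q]); last by rewrite setTI.
by rewrite -[X in closed X]setCK; exact/open_closedC/(op (~` [set f q])).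
Qed.

Lemma push_const a b x v : constant_map f -> push f a b x v = 0.
Proof.
move=> cf; rewrite /push (_ : local_rep f a b = cst (local_rep f a b x)) ?derive_cst//.
by apply/funext => y; congr (chart b _); exact: cf.
Qed.

Lemma harmonic_const : constant_map f -> harmonic_map f.
Proof.
move=> cf a b x xD; have [sN _ _ _] := metricP N.
have dh := smooth_differentiable (sN b) (local_rep_img xD).
rewrite /tension_field big1// => i _; rewrite big1// => j _.
rewrite /second_fundamental_form !push_const//.
rewrite (_ : (fun y => push f a b y _) = cst 0); last first.
  by apply/funext => y; exact: push_const.
by rewrite derive_cst -(scale0r 0) christoffelZr// !scale0r addr0 subrr scaler0.
Qed.

End ConstantMaps.

Section HermitianJets.
Variables (R : realType) (m : nat) (H : almost_hermitian R m).
Variables (a : atlas H) (x : 'rV[R]_(m.*2)).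
Hypothesis ax : cimg a x.

Lemma hermitian_jet : structure_jet (metric a x) (J_ a x) 0 (nablaJ a x) (fun=> 0).
Proof.
have [sG _ Gsym Gpos] := metricP H; have [sJ _] := J_field H.
have dG := smooth_differentiable (sG a) ax.
have dJ := smooth_differentiable (sJ a) ax.
have E : (fun u => nabla (metric a) (cst u) (cst 0) x) = fun=> 0.
  by apply/funext => u; rewrite nabla_cst -(scale0r 0) christoffelZr// !scale0r.
rewrite -E; apply: (field_jet (ga := cst 0) (U := cimg a)) => //.
- exact: cimg_open.
- exact: Gsym.
- exact: Gpos.
- by move=> y ay v; rewrite -mulmxA J_sqr// mulmxN mulmx1 scaler0 addr0.
- by move=> y ay; rewrite mul0mx.
- by move=> y ay v w; apply: hermitian_skew; [exact: J_sqr|exact: J_compat].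
Qed.

Lemma J_frame_exists : exists e : 'I_m -> 'rV[R]_(m.*2), J_frame a x e.
Proof.
have [_ _ Gsym Gpos] := metricP H.
by apply: hermitian_frame_exists; [exact: Gsym|exact: Gpos|exact: J_sqr|exact: J_compat].
Qed.

(** The defect is S(Jv,v) by conversion, which settles the quasi-Kähler case; for almost Kähler
    manifolds the vanishing cyclic sum is the case b = 0 of [defect_cyclic]. *)
Lemma C1_defect v : class_C1 H -> defect (J_ a x) (nablaJ a x) v = 0.
Proof.
have jet := hermitian_jet; have v0 : ip (metric a x) v 0 = 0 by rewrite ip0r.
have [sG _ Gsym Gpos] := metricP H; have [sJ _] := J_field H.
case=> [K|[K|[K|K]]].
- by rewrite /defect !(K a x ax) subrr.
- exact: (defect_nearly jet (K a x ax)).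
- have := defect_cyclic jet (b := 0) _ v0; rewrite scaler0; apply => u w z.
  rewrite mulr0 mul0r /cyclic_D.
  have F s t r : ip (metric a x) s (nablaJ a x t r) =
      nabla_form2 (metric a) (Phi a) x t s r.
    symmetry; apply: (nabla_form2E (U := cimg a)) => //.
    + exact: cimg_open.
    + exact: smooth_differentiable (sG a) ax.
    + exact: smooth_differentiable (sJ a) ax.
    + exact: Gsym.
    + exact: Gpos.
  rewrite !F; exact: K.
- exact: K.
Qed.

End HermitianJets.

Section ContactJets.
Variables (R : realType) (n : nat) (N : almost_contact R n).
Variables (a : atlas N) (x : 'rV[R]_(n.*2.+1)).
Hypothesis ax : cimg a x.
Local Notation h := (metric a x).
Local Notation psi := (phi_ a x).
Local Notation ga := (gamma_ a x).

(** phi^2 gamma = 0, so phi^3 gamma = 0 forces phi gamma = c gamma; then c^2 = 0. *)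
Lemma gamma_phi : ga *m psi = 0.
Proof.
pose c := sg a x (ga *m psi).
have g0 : ga *m psi *m psi = 0 by rewrite phi_sqr// sigma_gamma// scale1r addNr.
have E : ga *m psi = c *: ga.
  have := phi_sqr ax (ga *m psi); rewrite g0 mul0mx => /esym/eqP.
  by rewrite addrC subr_eq0 => /eqP.
have : ev (sigma_ a x) (ga *m psi *m psi) = c ^+ 2.
  rewrite E -scalemxAl E scalerA -expr2 /ev -scalemxAl [LHS]mxE.
  by rewrite -[X in _ * X]/(ev (sigma_ a x) ga) sigma_gamma// mulr1.
rewrite g0 /ev mul0mx mxE => /esym/eqP; rewrite sqrf_eq0 => /eqP c0.
by rewrite E c0 scale0r.
Qed.

Lemma sigma_metric v : ev (sigma_ a x) v = ip h v ga.
Proof.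
have := phi_compat ax v ga; rewrite gamma_phi ip0r sigma_gamma// mulr1.
by move=> /esym/eqP; rewrite subr_eq0 => /eqP.
Qed.

Lemma gamma_unit : ip h ga ga = 1.
Proof. by rewrite -sigma_metric sigma_gamma. Qed.

Lemma phi_skew v w : ip h (v *m psi) w = - ip h v (w *m psi).
Proof.
(* The image of phi is horizontal: evaluating phi^3 u in two ways leaves sigma(phi u) gamma = 0. *)
have sp u : ip h (u *m psi) ga = 0.
  have := phi_sqr ax (u *m psi); rewrite (phi_sqr ax u) mulmxDl mulNmx -scalemxAl.
  rewrite gamma_phi scaler0 addr0 => /eqP; rewrite -subr_eq0 opprD addNKr.
  rewrite oppr_eq0 => /eqP E; rewrite -sigma_metric.
  have := congr1 (fun v => ip h v ga) E; rewrite ipZl ip0l.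
  by rewrite -!sigma_metric sigma_gamma// mulr1.
have := phi_compat ax v (w *m psi).
rewrite (sigma_metric (w *m psi)) sp mulr0 subr0 => <-.
by rewrite phi_sqr// ipDr ipNr ipZr sp mulr0 addr0 opprK.
Qed.

End ContactJets.

Section ContactFields.
Variables (R : realType) (n : nat) (N : almost_contact R n).
Variables (a : atlas N) (x : 'rV[R]_(n.*2.+1)).
Hypothesis ax : cimg a x.
Local Notation h := (metric a x).
Local Notation psi := (phi_ a x).
Local Notation ga := (gamma_ a x).

Let dh : differentiable (metric a) x.
Proof. by have [s _ _ _] := metricP N; exact: smooth_differentiable (s a) ax. Qed.

Let dpsi : differentiable (phi_ a) x.
Proof. by have [s _] := phi_field N; exact: smooth_differentiable (s a) ax. Qed.

Let dga : differentiable (gamma_ a) x.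
Proof. by have [s _] := gamma_field N; exact: smooth_differentiable (s a) ax. Qed.

Let hsym y : cimg a y -> (metric a y)^T = metric a y.
Proof. by have [_ _ s _] := metricP N; exact: s. Qed.

Let hpos : pos_def h.
Proof. by have [_ _ _ s] := metricP N; exact: s. Qed.

Let oU : open (cimg a). Proof. exact: cimg_open. Qed.

Lemma contact_jet : structure_jet h psi ga (nablaphi a x) (nablagamma a x).
Proof.
apply: (field_jet (U := cimg a)) => //.
- by move=> y ay v; rewrite phi_sqr// sigma_metric.
- by move=> y ay; exact: gamma_phi.
- by move=> y ay v w; exact: phi_skew.
Qed.

Lemma dOmegaE u v w : dOmega a x u v w = cyclic_D h (nablaphi a x) u v w.
Proof.
by rewrite /dOmega /d_form2 /cyclic_D;
  congr (_ + _ + _); apply: (nabla_form2E (U := cimg a)).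
Qed.

Lemma dsigmaE v w : dsigma a x v w =
  2^-1 * (ip h w (nablagamma a x v) - ip h v (nablagamma a x w)).
Proof.
by apply: (d_form1E (U := cimg a)) => // y ay z; exact: sigma_metric.
Qed.

Lemma nablagamma_ga u : ip h (nablagamma a x u) ga = 0.
Proof.
have E : \near x, ip (metric a x) (gamma_ a x) (gamma_ a x) = cst 1 x.
  by apply: filterS (open_nbhs_nbhs (conj oU ax)) => y ay; exact: gamma_unit.
have := near_eq_derive u E; rewrite derive_cst (nabla_ip dh _ _ u dga dga).
- by rewrite [X in _ + X](ip_sym _ _ (hsym ax)) -/(nablagamma a x u); lra.
- by apply: filterS (open_nbhs_nbhs (conj oU ax)) => y ay; exact: hsym.
- exact: pos_def_unit.
Qed.

End ContactFields.

(** * Holomorphic maps *)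

Section HolomorphicMaps.
Variables (R : realType) (m k : nat) (H : almost_hermitian R m) (N : riemannian R k).
Variables (psi : atlas N -> 'rV[R]_k -> 'M[R]_k) (ga : atlas N -> 'rV[R]_k -> 'rV[R]_k).
Variable Nga : atlas N -> 'rV[R]_k -> 'rV[R]_k -> 'rV[R]_k.
Hypothesis psi_diff : forall b y, cimg b y -> differentiable (psi b) y.
Hypothesis psi_jet : forall b y, cimg b y ->
  structure_jet (metric b y) (psi b y) (ga b y) (nabla_endo (metric b) (psi b) y)
    (Nga b y).
Variable f : H -> N.
Hypotheses (sf : smooth_map f) (hf : pm_holomorphic (@J_ R m H) psi f).

Section Point.
Variables (a : atlas H) (b : atlas N) (x : 'rV[R]_(m.*2)).
Hypothesis xD : local_dom f a b x.
Let y := local_rep f a b x.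
Let yb : cimg b y. Proof. exact: local_rep_img. Qed.
Let ax : cimg a x. Proof. by case: xD. Qed.
Let F := jac (local_rep f a b) x.
Let oD : open (local_dom f a b). Proof. by apply: open_local_dom; case: sf. Qed.

Let dg : differentiable (metric a) x.
Proof. by have [s _ _ _] := metricP H; exact: smooth_differentiable (s a) ax. Qed.

Let dh : differentiable (metric b) y.
Proof. by have [s _ _ _] := metricP N; exact: smooth_differentiable (s b) yb. Qed.

Lemma pushE v : push f a b x v = v *m F.
Proof. exact: (derive_jac (sf.2 a b) v xD). Qed.

Lemma sff_linear u : linear (second_fundamental_form f a b x u).
Proof. exact: (sff_linearr oD xD (sf.2 a b) dg dh). Qed.

Lemma sff_sym u v :
  second_fundamental_form f a b x u v = second_fundamental_form f a b x v u.
Proof.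
apply: (sffC oD xD (sf.2 a b)).
- have [_ _ s _] := metricP H; apply: filterS (open_nbhs_nbhs (conj _ ax)) => [z az|].
    exact: s.
  exact: cimg_open.
- have [_ _ s _] := metricP N; apply: filterS (open_nbhs_nbhs (conj _ yb)) => [z az|].
    exact: s.
  exact: cimg_open.
Qed.

Let sffN u v : second_fundamental_form f a b x u (- v) =
  - second_fundamental_form f a b x u v.
Proof.
have T0 : second_fundamental_form f a b x u 0 = 0.
  by have := sff_linear u 1 0 0; rewrite !scale1r addr0 => /eqP;
    rewrite -subr_eq0 opprD addNKr oppr_eq0 => /eqP.
by have := sff_linear u (-1) v 0; rewrite T0 !addr0 !scaleN1r.
Qed.

Lemma holo_point : exists2 s : R, s * s = 1 &
  (forall v : 'rV[R]_(m.*2), v *m J_ a x *m F = s *: (v *m F *m psi b y)) /\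
  (forall u w : 'rV[R]_(m.*2),
    second_fundamental_form f a b x u (w *m J_ a x) + nablaJ a x u w *m F =
    s *: (nabla_endo (metric b) (psi b) y (u *m F) (w *m F)
          + second_fundamental_form f a b x u w *m psi b y)).
Proof.
have [s sP] := hf; exists ((-1) ^+ s); first by rewrite -expr2 sqrr_sign.
split; first by move=> v; rewrite -!pushE sP.
have [sJ _] := J_field H.
have dJ := smooth_differentiable (sJ a) ax.
exact: (sff_holo _ oD xD (sf.2 a b) dh dJ (psi_diff yb) (sP a b)).
Qed.

Lemma push_horizontal v : ip (metric b y) (push f a b x v) (ga b y) = 0.
Proof.
have [s _ [FJ _]] := holo_point; rewrite pushE.
exact: (holo_horizontal (hermitian_jet ax) (psi_jet yb) FJ).
Qed.

Lemma push_closed u w :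
  ip (metric b y) (push f a b x w) (Nga b y (push f a b x u)) =
  ip (metric b y) (push f a b x u) (Nga b y (push f a b x w)).
Proof.
have [s s1 [FJ TJ]] := holo_point; rewrite !pushE.
exact: (holo_closed (hermitian_jet ax) (psi_jet yb) s1 sff_sym sffN FJ TJ).
Qed.

Lemma sff_J v : second_fundamental_form f a b x v v +
    second_fundamental_form f a b x (v *m J_ a x) (v *m J_ a x) =
  defect (psi b y) (nabla_endo (metric b) (psi b) y) (push f a b x v)
  - push f a b x (defect (J_ a x) (nablaJ a x) v).
Proof.
have [s s1 [FJ TJ]] := holo_point; rewrite !pushE.
exact: (holo_sff_sum (hermitian_jet ax) (psi_jet yb) s1 sff_sym sffN FJ TJ).
Qed.

(** The frame vectors are paired as e_i, J e_i; the source terms sum to the semi-Kähler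
    expression. *)
Lemma tension_J_frame (e : 'I_m -> 'rV[R]_(m.*2)) : semi_kahler H ->
  J_frame a x e -> tension_field f a b x =
  \sum_i defect (psi b y) (nabla_endo (metric b) (psi b) y) (push f a b x (e i)).
Proof.
move=> sK eJ; have cardI : #|{: 'I_m + 'I_m}| = m.*2.
  by rewrite card_sum card_ord addnn.
rewrite /tension_field (orthonormal_contraction cardI eJ sff_linear sff_sym).
rewrite big_sumType /= -big_split /=.
under eq_bigr do rewrite sff_J (pushE (defect _ _ _)).
rewrite sumrB -mulmx_suml -[RHS]subr0; congr (_ - _).
by rewrite [X in X *m _](sK a x ax e eJ) mul0mx.
Qed.

Lemma push_eq0 (e : 'I_m -> 'rV[R]_(m.*2)) : J_frame a x e ->
  (forall i, push f a b x (e i) = 0) -> forall v, push f a b x v = 0.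
Proof.
move=> eJ e0 v; have cardI : #|{: 'I_m + 'I_m}| = m.*2.
  by rewrite card_sum card_ord addnn.
have [_ _ _ Gpos] := metricP H.
have uG : metric a x \in unitmx by exact/pos_def_unit/Gpos.
have [s _ [FJ _]] := holo_point.
rewrite pushE (orthonormal_expand cardI eJ v uG) mulmx_suml big1// => -[i|i] _.
  by rewrite -scalemxAl -pushE e0 scaler0.
by rewrite -scalemxAl FJ -pushE e0 mul0mx !scaler0.
Qed.

End Point.

Lemma harmonic_of_defect0 : semi_kahler H ->
  (forall a b x, local_dom f a b x -> forall v,
     defect (psi b (local_rep f a b x))
       (nabla_endo (metric b) (psi b) (local_rep f a b x)) (push f a b x v) = 0) ->
  harmonic_map f /\ (class_C1 H -> pluriharmonic_map f).
Proof.
move=> sK d0; split=> [a b x xD|C1 a b x xD v].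
  have [e eJ] := J_frame_exists xD.1.
  by rewrite (tension_J_frame xD sK eJ) big1// => i _; exact: d0.
rewrite sff_J// d0// (C1_defect xD.1 v C1) pushE// mul0mx subr0//.
Qed.

(** In a J-frame the tension field is -2c times the sum of the |df(e_i)|^2, along [ga]; a vanishing
    sum of squares has vanishing terms. *)
Lemma harmonic_push0 (c : N -> R) : semi_kahler H ->
  (forall p, c p != 0) -> (forall b y, cimg b y -> ga b y != 0) ->
  (forall b y v, cimg b y -> ip (metric b y) v (ga b y) = 0 ->
     defect (psi b y) (nabla_endo (metric b) (psi b) y) v =
     (- (2 * c (chart_inv b y) * ip (metric b y) v v)) *: ga b y) ->
  harmonic_map f ->
  forall a b x, local_dom f a b x -> forall v, push f a b x v = 0.
Proof.
move=> sK c0 g0 dE harm a b x xD.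
have yb := local_rep_img xD; have [e eJ] := J_frame_exists xD.1.
have [_ _ _ Npos] := metricP N; have hpos := Npos b _ yb.
apply: (push_eq0 xD eJ) => i; apply: (ip_eq0 hpos).
have := harm a b x xD; rewrite (tension_J_frame xD sK eJ).
under eq_bigr do rewrite dE ?push_horizontal//.
rewrite -scaler_suml => /eqP; rewrite scaler_eq0 (negPf (g0 _ _ yb)) orbF.
rewrite sumrN oppr_eq0 -mulr_sumr !mulf_eq0 pnatr_eq0 (negPf (c0 _)) /=.
rewrite psumr_eq0 => [/allP/(_ i)|j _]; last exact: ip_ge0.
by rewrite mem_index_enum => /(_ isT)/eqP.
Qed.

End HolomorphicMaps.

(** * Almost contact metric targets: parts (i) and (ii) *)

Section ContactTargets.
Variables (R : realType) (m n : nat) (H : almost_hermitian R m) (N : almost_contact R n).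
Variable f : H -> N.
Hypotheses (sf : smooth_map f) (hf : pm_holomorphic (@J_ R m H) (@phi_ R n N) f).
Hypothesis sK : semi_kahler H.

Let phi_diff b y : cimg b y -> differentiable (@phi_ R n N b) y.
Proof. by move=> yb; have [s _] := phi_field N; exact: smooth_differentiable (s b) yb. Qed.

Let phi_jet (b : atlas N) y (yb : cimg b y) := contact_jet yb.

Let horizontal a b x (xD : local_dom f a b x) v :=
  push_horizontal phi_diff phi_jet sf hf xD v.

(** For X in the image of df, psi X is in it too, so d sigma(X, psi X) = 0, whereas the contact
    condition makes it -alpha |X|^2. *)
Lemma alpha_contact_push0 alpha : alpha != 0 -> alpha_contact_with N alpha ->
  forall a b x, local_dom f a b x -> forall v, push f a b x v = 0.
Proof.
move=> a0 ac a b x xD v; have yb := local_rep_img xD.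
have [_ _ _ Npos] := metricP N; apply: (ip_eq0 (Npos b _ yb)).
have [s s1 [FJ _]] := holo_point phi_diff sf hf xD.
set y := local_rep f a b x in yb s1 FJ *; set X := push f a b x v.
pose w : 'rV[R]_(m.*2) := s *: (v *m J_ a x).
have Fw : push f a b x w = X *m phi_ b y.
  rewrite (pushE sf xD) -scalemxAl FJ scalerA s1 scale1r.
  by rewrite -(pushE sf xD).
have := push_closed phi_diff phi_jet sf hf xD v w; rewrite -/y Fw -/X => E.
have := ac b y yb X (X *m phi_ b y); rewrite (dsigmaE yb) E subrr mulr0.
rewrite /Omega (sqr_ker (phi_jet yb)) ?ipNr; last exact: horizontal.
by move=> /esym/eqP; rewrite mulf_eq0 (negPf a0) oppr_eq0 => /eqP.
Qed.

Lemma contact_defect0 : class_A1 N \/ class_A4a N \/ class_B1 N ->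
  forall a b x, local_dom f a b x -> forall v,
  defect (phi_ b (local_rep f a b x)) (nablaphi b (local_rep f a b x))
    (push f a b x v) = 0.
Proof.
move=> cN a b x xD v; have yb := local_rep_img xD.
have hX := horizontal xD v; have jet := phi_jet yb.
have alphaE alpha : alpha != 0 -> alpha_contact_with N alpha ->
    defect (phi_ b (local_rep f a b x)) (nablaphi b (local_rep f a b x))
      (push f a b x v) = 0.
  move=> a0 ac; rewrite (alpha_contact_push0 a0 ac xD).
  by rewrite /defect mul0mx subrr.
set y := local_rep f a b x in yb hX jet alphaE *.
move: (push f a b x v) hX alphaE => X hX alphaE.
(* This is P(psi X, X) because psi^2 X = -X; in the classes given by a formula for P, each term then
   carries a factor sigma(X) or h(psi X, X), both zero. *)
have defectPN : defect (phi_ b y) (nablaphi b y) X = PN b y (X *m phi_ b y) X.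
  by rewrite /PN (sqr_ker jet hX) (jetNl jet).
have sX : sg b y X = 0 by rewrite /sg sigma_metric.
have hXX : ip (metric b y) (X *m phi_ b y) X = 0.
  by rewrite (jet_skew jet) (ip_psi_self jet) oppr0.
have closed : (forall u v w, dOmega b y u v w = 0) ->
    defect (phi_ b y) (nablaphi b y) X = 0.
  move=> dO; rewrite (defect_cyclic jet (b := 0) _ hX) => [|u z w].
    by rewrite mulr0 mul0r oppr0 scale0r.
  by rewrite mulr0 mul0r -dOmegaE.
have nearly : nearly_cosymplectic N -> defect (phi_ b y) (nablaphi b y) X = 0.
  by move=> nc; apply: (defect_nearly jet _ hX) => w; exact: nc.
case: cN => [|[|]].
- case=> [[alpha [a0 ac]]|[qc|[qK|[[ac _]|[[alpha [a0 ac]] _]]]]].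
  + exact: alphaE a0 ac.
  + by rewrite defectPN qc// hXX sX mulr0 !scale0r subrr.
  + by rewrite defectPN qK// hXX sX !mulr0 !scale0r subrr addr0.
  + exact: alphaE (oner_neq0 _) ac.
  + exact: alphaE a0 ac.
- by move=> [dO _]; apply: closed => u z w; exact: dO.
- case=> [[ac _]|[ac|[nc|[[nc _]|qK]]]].
  + by apply: closed; exact: (ac b y yb).2.
  + by apply: closed; exact: (ac b y yb).2.
  + exact: nearly.
  + exact: nearly.
  + by rewrite defectPN qK// sX scale0r.
Qed.

Lemma gamma_neq0 b y : cimg b y -> @gamma_ R n N b y != 0.
Proof.
move=> yb; apply/eqP => g0; have := gamma_unit yb.
by rewrite g0 ip0l => /esym/eqP; rewrite oner_eq0.
Qed.

(** The [wp]-terms carry h(v, psi v) = 0; the two [theta]-terms each contribute -theta |v|^2. *)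
Lemma trans_sasakian_defect wp theta b y v : trans_sasakian (N := N) wp theta ->
  cimg b y -> ip (metric b y) v (gamma_ b y) = 0 ->
  defect (phi_ b y) (nablaphi b y) v =
  (- (2 * theta (chart_inv b y) * ip (metric b y) v v)) *: gamma_ b y.
Proof.
move=> [_ E _ _] yb hv; have jet := phi_jet yb.
have sv : sg b y v = 0 by rewrite /sg sigma_metric.
have spv : sg b y (v *m phi_ b y) = 0.
  by rewrite /sg sigma_metric// (ip_psi_ga jet).
rewrite /defect !E// sv spv !scale0r !subr0 (sqr_ker jet hv) ipNl.
rewrite (ip_psi_psi jet) // (jet_skew jet) (ip_psi_self jet) oppr0.
move: (ip _ v v) (wp _) (theta _) (gamma_ b y) => c d t z.
by apply/rowP => j; rewrite !mxE; ring.
Qed.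

Lemma kenmotsu_defect beta b y v : almost_kenmotsu_with (N := N) beta ->
  cimg b y -> ip (metric b y) v (gamma_ b y) = 0 ->
  defect (phi_ b y) (nablaphi b y) v =
  (- (2 * beta (chart_inv b y) * ip (metric b y) v v)) *: gamma_ b y.
Proof.
move=> [_ _ K] yb hv; have [dO _ _] := K b y yb.
apply: (defect_cyclic (phi_jet yb)) => // u z w.
by rewrite -dOmegaE// dO /sigma_wedge_Omega /sg !sigma_metric.
Qed.

Lemma harmonic_constant : connected [set: H] -> class_A3 N \/ class_B3 N ->
  (harmonic_map f <-> constant_map f).
Proof.
move=> cH cN; split=> [harm|]; last exact: harmonic_const.
have [c c0 cE] : exists2 c : N -> R, forall p, c p != 0 &
  forall b y v, cimg b y -> ip (metric b y) v (gamma_ b y) = 0 ->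
    defect (phi_ b y) (nablaphi b y) v =
    (- (2 * c (chart_inv b y) * ip (metric b y) v v)) *: gamma_ b y.
  case: cN => [[wp [theta [_ _ _ t0 tS]]]|[beta K]].
    by exists theta => // b y v; exact: (trans_sasakian_defect tS).
  have K' : almost_kenmotsu_with (N := N) beta by case: K => [|[[]|[]]].
  exists beta; first by case: K'.
  by move=> b y v; exact: kenmotsu_defect.
apply: (constant_of_push0 sf cH).
exact: (harmonic_push0 phi_diff phi_jet sf hf sK c0 gamma_neq0 cE harm).
Qed.

(** Normality at (v, gamma), paired with gamma, gives d sigma(v, gamma) = 0. Hence h(v, nabla_gamma
    gamma) = h(gamma, nabla_v gamma), which is zero since gamma has unit length. *)
Lemma normal_geodesic (b : atlas N) y : normal_ac N -> cimg b y ->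
  nablagamma b y (gamma_ b y) = 0.
Proof.
move=> nN yb; have jet := phi_jet yb.
have [_ _ hs hp] := metricP N; have hsym := hs b y yb; have hpos := hp b y yb.
have dphi := phi_diff yb.
have dga : differentiable (gamma_ b) y.
  by have [s _] := gamma_field N; exact: smooth_differentiable (s b) yb.
have dsg v : dsigma b y v (gamma_ b y) = 0.
  (* Differentiating phi gamma = 0 puts the remaining Nijenhuis terms in the image of phi,
     orthogonal to gamma. *)
  have Dga u : gamma_ b y *m 'D_u (phi_ b) y = - ('D_u (gamma_ b) y *m phi_ b y).
    have E : \near y, gamma_ b y *m phi_ b y = cst 0 y.
      have oU : open (cimg b) by exact: cimg_open.
      by apply: filterS (open_nbhs_nbhs (conj oU yb)) => z zb; exact: gamma_phi.
    have := near_eq_derive u E; rewrite derive_cst (derive_mulmx u dga dphi).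
    by rewrite addrC => /eqP; rewrite addr_eq0 => /eqP.
  have := nN b y yb v (gamma_ b y).
  rewrite /nijenhuis /nijenhuis_vf /lie /= !derive_cst !derive_mulmxl//.
  rewrite gamma_phi// derive0 !Dga mulmx0 subr0.
  move: ('D_(v *m _) (gamma_ b) y) ('D_v (gamma_ b) y) ('D__ (phi_ b) y) => c d e E.
  have := congr1 (fun u => ip (metric b y) u (gamma_ b y)) E.
  rewrite !(ipDl, ipNl, ipZl, ip0l) !(ip_psi_ga jet) gamma_unit//.
  lra.
apply: (ip_inj hpos) => v; rewrite ip0r.
have := dsg v; rewrite dsigmaE// (ip_sym _ (nablagamma _ _ v) hsym).
by rewrite nablagamma_ga//; lra.
Qed.

End ContactTargets.

(** * Semi-cosymplectic targets: part (iii) *)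

Section SemiCosymplectic.
Variables (R : realType) (n : nat) (H : almost_hermitian R n) (N : almost_contact R n).
Variable f : H -> N.
Hypotheses (sf : smooth_map f) (hf : pm_holomorphic (@J_ R n H) (@phi_ R n N) f).

Lemma phi_frame_defect (b : atlas N) y (e : 'I_n -> 'rV[R]_(n.*2.+1)) :
  semi_cosymplectic N -> cimg b y -> phi_frame b y e ->
  \sum_i defect (phi_ b y) (nablaphi b y) (e i) = 0.
Proof.
move=> [ds dO nN] yb eP; have jet := contact_jet yb.
have [_ _ hs hp] := metricP N; have hsym := hs b y yb; have hpos := hp b y yb.
have Ng := normal_geodesic nN yb.
have sumP : \sum_i PN b y (e i) (e i) = 0.
  (* delta Omega vanishes on every vector, in particular on this sum itself. *)
  apply: (ip_eq0 hpos); rewrite -[RHS](dO b y yb e eP (\sum_i PN b y (e i) (e i))).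
  have Ng' : nabla (metric b) (gamma_ b) (gamma_ b) y = 0 by exact: Ng.
  by rewrite /delta_Omega Ng' mul0mx oppr0 add0r.
have he i : ip (metric b y) (e i) (gamma_ b y) = 0.
  by have := eP (Some (inl i)) None.
have div0 : \sum_i (ip (metric b y) (e i) (nablagamma b y (e i)) +
    ip (metric b y) (e i *m phi_ b y) (nablagamma b y (e i *m phi_ b y))) = 0.
  have [sh _ _ _] := metricP N; have [sg _] := gamma_field N.
  have dh := smooth_differentiable (sh b) yb.
  have dga := smooth_differentiable (sg b) yb.
  (* The matrix of v |-> nabla_v gamma. Its trace is div gamma; in a phi-frame the gamma-term of the
     trace is zero. *)
  pose L : 'M[R]_(n.*2.+1) := \matrix_(i, j) nablagamma b y (basis_vec R i) 0 j.
  have LE v : v *m L = nablagamma b y v.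
    rewrite [v in RHS]row_sum_delta.
    have : forall s : seq 'I_(n.*2.+1),
        nablagamma b y (\sum_(j <- s) v 0 j *: delta_mx 0 j) =
        \sum_(j <- s) v 0 j *: nablagamma b y (basis_vec R j).
      have ND u w : nablagamma b y (u + w) = nablagamma b y u + nablagamma b y w.
        exact: nabla_dirD.
      have NZ c u : nablagamma b y (c *: u) = c *: nablagamma b y u.
        exact: nabla_dirZ.
      have N0 : nablagamma b y 0 = 0 by rewrite -(scale0r 0) NZ !scale0r.
      elim=> [|j s IH]; first by rewrite !big_nil.
      by rewrite !big_cons ND NZ IH.
    move=> ->; apply/rowP => j; rewrite mxE summxE.
    by apply: eq_bigr => i _; rewrite !mxE.
  have cardI : #|{: option ('I_n + 'I_n)}| = n.*2.+1.
    by rewrite card_option card_sum card_ord addnn.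
  have uh : metric b y \in unitmx by exact: pos_def_unit.
  have := ds b y yb; rewrite /delta_sigma => /eqP; rewrite oppr_eq0 => /eqP.
  have -> : divergence (metric b) (gamma_ b) y = \tr L.
    by apply: eq_bigr => i _; rewrite [RHS]mxE.
  rewrite (orthonormal_trace cardI eP L uh) (bigD1 None)//= LE nablagamma_ga// add0r.
  rewrite (reindex_omap Some id)/= => [|[]//]; under eq_bigl do rewrite eqxx.
  rewrite big_sumType /= -big_split /= => E; rewrite -[RHS]E.
  apply: eq_bigr => i _; rewrite !LE.
  by congr (_ + _); exact: ip_sym.
under eq_bigr do rewrite (defect_P jet (he _)).
by rewrite sumrB -mulmx_suml sumP mul0mx -scaler_suml div0 scale0r subrr.
Qed.

Lemma semi_cosymplectic_harmonic : semi_kahler H -> semi_cosymplectic N ->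
  weakly_conformal f -> harmonic_map f.
Proof.
move=> sK sN [mu [mu0 muE]] a b x xD.
have yb := local_rep_img xD; have jet := contact_jet yb.
have [_ _ _ hp] := metricP N; have hpos := hp b _ yb.
have phi_diff b' y' : cimg b' y' -> differentiable (@phi_ R n N b') y'.
  by move=> yb'; have [s _] := phi_field N; exact: smooth_differentiable (s b') yb'.
pose phi_jet (b' : atlas N) y' (yb' : cimg b' y') := contact_jet yb'.
have [e eJ] := J_frame_exists xD.1.
rewrite (tension_J_frame phi_diff phi_jet sf hf xD sK eJ) -/(nablaphi b _).
have [s s1 [FJ _]] := holo_point phi_diff sf hf xD.
have hor v := push_horizontal phi_diff phi_jet sf hf xD v.
have conf := muE a b x xD.
set y := local_rep f a b x in yb jet hpos s1 FJ hor conf *.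
set r := mu _ in conf.
(* Where mu = 0, conformality makes df vanish; elsewhere the vectors df(e_i)/mu form a phi-frame and
   Q scales by mu^2. *)
have [r0|r0] := eqVneq r 0.
  rewrite big1// => i _; rewrite (_ : push f a b x (e i) = 0).
    by rewrite /defect mul0mx subrr.
  by apply: (ip_eq0 hpos); rewrite conf r0 expr0n mul0r.
have eE i : push f a b x (e i) = r *: (r^-1 *: push f a b x (e i)).
  by rewrite scalerA mulfV// scale1r.
under eq_bigr do rewrite eE (defectZ jet).
rewrite -scaler_sumr (phi_frame_defect sN yb) ?scaler0//.
have Fpsi i : push f a b x (e i) *m phi_ b y = s *: push f a b x (e i *m J_ a x).
  by rewrite !(pushE sf xD) FJ scalerA s1 scale1r.
have r2 : r^-1 * (r^-1 * r ^+ 2) = 1 by rewrite expr2 mulKf// mulVf.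
have orth i j : ip (metric b y) (r^-1 *: push f a b x (e i))
    (r^-1 *: push f a b x (e j)) = (i == j)%:R.
  have G : ip (metric a x) (e i) (e j) = (i == j)%:R by exact: (eJ (inl i) (inl j)).
  by rewrite ipZl ipZr conf G -[RHS]mul1r -[X in _ = X * _]r2 !mulrA.
have orthJ i j : ip (metric b y) (r^-1 *: push f a b x (e i))
    (r^-1 *: push f a b x (e j) *m phi_ b y) = 0.
  rewrite -scalemxAl Fpsi ipZl !ipZr conf.
  have -> : ip (metric a x) (e i) (e j *m J_ a x) = 0 by exact: (eJ (inl i) (inr j)).
  by rewrite !mulr0.
have hor' v : ip (metric b y) (r^-1 *: push f a b x v) (gamma_ b y) = 0.
  by rewrite ipZl hor mulr0.
move=> [[i|i]|] [[j|j]|] //=.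
- by rewrite (jet_skew jet) orthJ oppr0.
- by rewrite (ip_psi_psi jet)// orth.
- exact: (ip_psi_ga jet).
- by rewrite (ip_sym _ _ (jet_sym jet)) hor'.
- by rewrite (ip_sym _ _ (jet_sym jet)) (ip_psi_ga jet).
- exact: gamma_unit.
Qed.

End SemiCosymplectic.

Theorem theorem4p9 (R : realType) (m : nat) (H : almost_hermitian R m)
    (H_C2 : semi_kahler H) :
  (* (i), almost contact metric target *)
  (forall (n : nat) (N : almost_contact R n) (f : H -> N),
     smooth_map f -> pm_holomorphic (@J_ R m H) (@phi_ R n N) f ->
     class_A1 N \/ class_A4a N \/ class_B1 N ->
     harmonic_map f /\ (class_C1 H -> pluriharmonic_map f)) /\
  (* (i), almost Hermitian target *)
  (forall (k : nat) (N : almost_hermitian R k) (f : H -> N),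
     smooth_map f -> pm_holomorphic (@J_ R m H) (@J_ R k N) f ->
     class_C1 N ->
     harmonic_map f /\ (class_C1 H -> pluriharmonic_map f)) /\
  (* (ii) *)
  (connected [set: H] ->
   forall (n : nat) (N : almost_contact R n) (f : H -> N),
     smooth_map f -> pm_holomorphic (@J_ R m H) (@phi_ R n N) f ->
     class_A3 N \/ class_B3 N ->
     (harmonic_map f <-> constant_map f)) /\
  (* (iii) *)
  (forall (n : nat) (N : almost_contact R n) (f : H -> N),
     smooth_map f -> pm_holomorphic (@J_ R m H) (@phi_ R n N) f ->
     class_B2 N -> (n.*2.+1 = 1 + m.*2)%N -> weakly_conformal f ->
     harmonic_map f).
Proof.
split; [|split; [|split]].
- move=> n N f sf hf cN.
  apply: (harmonic_of_defect0 (psi := @phi_ R n N) (ga := @gamma_ R n N)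
    (Nga := fun b y => nablagamma b y)) => //.
  + move=> b y yb; have [s _] := phi_field N; exact: smooth_differentiable (s b) yb.
  + by move=> b y yb; exact: contact_jet.
  + by move=> a b x xD v; exact: contact_defect0.
- move=> k N f sf hf cN.
  apply: (harmonic_of_defect0 (psi := @J_ R k N) (ga := fun _ => cst 0)
    (Nga := fun _ _ _ => 0)) => //.
  + move=> b y yb; have [s _] := J_field N; exact: smooth_differentiable (s b) yb.
  + by move=> b y yb; exact: hermitian_jet.
  + by move=> a b x xD v; apply: C1_defect => //; exact: local_rep_img.
- by move=> cH n N f sf hf cN; exact: harmonic_constant.
(* The dimension condition forces n = m, so J-frames of H and phi-frames of N are indexed alike. *)
- move=> n N f sf hf cN; rewrite add1n => -[/double_inj nm]; subst n.
  exact: semi_cosymplectic_harmonic.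
Qed.
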